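(* Let $G=\mathbb Z^d$ with $d\ge 3$, and let $(y_n)$ be a positive sequence such that $(\log n)^{1/2}\ll y_n\ll n^{1/6}$. If $\mathbb E\xi^4<\infty$, then $$\limsup_{n\to\infty} y_n^{-2d/(d+2)}(\log n)^{-2/(d+2)}\log \mathbb P\otimes P\left(\frac{T_n\sqrt n}{V_nL_{n,2}}\ge y_n\right)<0.$$
   Context: $\{S_n:n\in\mathbb N_0\}$ is the simple random walk on $\mathbb Z^d$ started at the origin, with law $P$. The scenery $\{\xi(z):z\in\mathbb Z^d\}$ is a family of independent copies of a real random variable $\xi$, with law $\mathbb P$ and expectation $\mathbb E$, independent of the walk; $\mathbb P\otimes P$ is the joint law. It is always assumed that $\mathbb E\xi=0$ and $\mathbb E\xi^2>0$. The local time is $\ell_n(z)=\sum_{k=0}^n \mathbf 1\{S_k=z\}$, and $$T_n=\sum_{k=0}^n\xi(S_k)=\sum_{z}\ell_n(z)\xi(z),\quad V_n=\Big(\sum_{z}\ell_n(z)\xi^2(z)\Big)^{1/2},\quad L_{n,2}=\Big(\sum_{z}\ell_n^2(z)\Big)^{1/2}.$$ For positive sequences, $a_n\ll b_n$ means $a_n/b_n\to0$. When $V_n=0$ (so that $T_n=0$) the ratio is interpreted as $0$. Also $\log 0=-\infty$. *)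

(* Defs.v *)
From HB Require Import structures.
From mathcomp Require Import all_boot all_order all_algebra finmap.
From mathcomp Require Import all_classical all_reals all_analysis.

Set Implicit Arguments.
Unset Strict Implicit.
Unset Printing Implicit Defensive.

Import Order.TTheory GRing.Theory Num.Theory.
Import numFieldNormedType.Exports.

Local Open Scope classical_set_scope.
Local Open Scope ring_scope.

Definition lattice (d : nat) := 'rV[int]_d.

HB.instance Definition _ (d : nat) := GRing.Zmodule.on (lattice d).
HB.instance Definition _ (d : nat) := isPointed.Build (lattice d) 0.
HB.instance Definition _ (d : nat) :=
  @isMeasurable.Build default_measure_display (lattice d)
    discrete_measurable discrete_measurable0
    discrete_measurableC discrete_measurableU.

(* Product rule over every finite subfamily; the measurability of each [X i]
   is a separate requirement on the family. *)
Definition mutually_independent (R : realType) dT (T : measurableType dT)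
    (P : probability T R) (I : choiceType) dU (U : measurableType dU)
    (X : I -> T -> U) : Prop :=
  forall (J : {fset I}) (B : I -> set U), (forall i, measurable (B i)) ->
    P (\bigcap_(i in [set` J]) (X i @^-1` B i)) =
    (\prod_(i <- J) P (X i @^-1` B i))%E.

(* Laws are only compared on measurable sets: [P] carries no information
   outside of them. *)
Definition same_law (R : realType) dT1 (T1 : measurableType dT1)
    (P1 : probability T1 R) dT2 (T2 : measurableType dT2)
    (P2 : probability T2 R) dU (U : measurableType dU)
    (X1 : {RV P1 >-> U}) (X2 : {RV P2 >-> U}) : Prop :=
  forall A : set U, measurable A -> distribution P1 X1 A = distribution P2 X2 A.

Definition iid_copies (R : realType) dT (T : measurableType dT)
    (P : probability T R) (I : choiceType) (X : I -> {RV P >-> R})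
    dT0 (T0 : measurableType dT0) (P0 : probability T0 R)
    (X0 : {RV P0 >-> R}) : Prop :=
  mutually_independent P (fun i => X i : T -> R) /\
  forall i, same_law (X i) X0.

Definition increment (R : realType) (d : nat) dT (T : measurableType dT)
    (P : probability T R) (S : nat -> {RV P >-> lattice d})
    (k : nat) (w : T) : lattice d :=
  S k.+1 w - S k w.

(* [(-1) ^+ b *: delta_mx 0 i] with [b : bool] ranges over the 2d unit vectors
   [e_i] and [- e_i]. *)
Definition simple_random_walk (R : realType) (d : nat) dT
    (T : measurableType dT) (P : probability T R)
    (S : nat -> {RV P >-> lattice d}) : Prop :=
  [/\ P [set w | S 0%N w = 0] = 1%E,
      forall (k : nat) (i : 'I_d) (b : bool),
        P [set w | increment S k w = (-1) ^+ b *: delta_mx 0 i] =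
        ((2 * d)%:R^-1)%:E &
      mutually_independent P (increment S)].

Section functionals.
Context {R : realType} {d : nat}.
Implicit Types (x : lattice d -> R) (s : nat -> lattice d).

Definition local_time s (n : nat) (z : lattice d) : nat :=
  (\sum_(k < n.+1) (s k == z))%N.

Definition scenery_sum x s (n : nat) : R := \sum_(k < n.+1) x (s k).

(* For fixed [s] and [n], [local_time s n] has finite support, so the finitely
   supported sums over the whole lattice below are the usual sums. *)
Definition scenery_var x s (n : nat) : R :=
  Num.sqrt (\sum_(z \in [set: lattice d]) (local_time s n z)%:R * x z ^+ 2).

Definition local_time_norm2 s (n : nat) : R :=
  Num.sqrt (\sum_(z \in [set: lattice d]) ((local_time s n z)%:R : R) ^+ 2).

(* When [scenery_var x s n = 0] the quotient is 0, since [0^-1 = 0]. *)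
Definition self_normalized x s (n : nat) : R :=
  scenery_sum x s n * Num.sqrt n%:R /
  (scenery_var x s n * local_time_norm2 s n).

End functionals.

Definition much_less (R : realType) (a b : nat -> R) : Prop :=
  a n / b n @[n --> \oo] --> (0 : R).

(* Main.v *)
Require Import Defs.
From HB Require Import structures.
From mathcomp Require Import all_boot all_order all_algebra finmap.
From mathcomp Require Import all_classical all_reals all_analysis.
From mathcomp Require Import measurable_realfun ring lra zify.

(** Write [l] for the local time, [V^2] for the sum of [l x^2], [L^2] for the sum
    of [l^2], and [K = y^(2d/(d+2)) (ln n)^(2/(d+2))] for the rate. With
    [X = y^2 / ln n] and [rho = X^(d/(d+2))] one has [K = rho ln n] and
    [y^2 = K rho^(2/d)], so that [rho] is the number of sites on which an
    optimal strategy would concentrate: making the scenery exceptionally large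
    at [rho] sites costs [rho ln n], and spending time [y^2] on [rho] sites
    costs [y^2 / rho^(2/d)], the same amount.

    The walk. In dimension at least 3 the expected time spent in a set of [N]
    sites is at most a constant times [N^(2/d)], uniformly over the set
    ([green_bound]); by Khas'minskii's argument the time spent there exceeds
    [y^2/8] with probability at most [2 exp (- c y^2 / N^(2/d))] ([hits_tail]).
    For [N] a small multiple of [rho] this beats the [n^(O(N))] choices of the
    set, so outside an event of probability [exp (- c K)] no set of [N] sites
    carries local time more than [y^2/8] ([mean_not_spread]).

    The scenery, along a path with that property. Let [lam] be a small multiple
    of [y / L] and call a site bad when [lam l |x| > 1/2].
    - Each single local time is at most [y^2/8], so that [L^2] is at most
      [n y^2], and [V^2] is at least a multiple of [n] by a Chernoff bound for a
      sum of nonnegative terms ([small_scenery_var]).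
    - The good sites contribute less than a multiple of [y L] outside an event
      of probability [exp (- c y^2)]: after the truncation at 1/2 the
      exponential moment with parameter [lam] is bounded by the second moment
      ([large_truncated_sum]).
    - Fewer than [N] sites carry local time more than [y^2/(8N)]. Among the
      others the bad ones have total expected number at most a constant times
      [y^10 / (N^3 n)], by the fourth moment; this is smaller than [N] by a power
      of [n] because [y^6 <= n], so at least [N] of them occur with probability
      at most [exp (- c N ln n)] ([many_large_values]).
    Outside these events there are at most [2N] bad sites, carrying local time at
    most [y^2/4], hence contributing at most [y V / 2] to the sum by Cauchy and
    Schwarz; since [L^2 >= n], neither part lets the self-normalized sum reach
    [y] ([self_normalized_cases]).

    The law of the first [n] steps is uniform on the words of length [n] in the
    [2d] unit vectors, so expectations over the walk are finite averages
    ([word_mean]), and the joint event is covered by finitely many rectangles up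
    to a null set ([walk_event_le]). *)

Set Implicit Arguments.
Unset Strict Implicit.
Unset Printing Implicit Defensive.

Import Order.TTheory GRing.Theory Num.Theory.
Import numFieldNormedType.Exports.

Local Open Scope classical_set_scope.
Local Open Scope ring_scope.

(** * Binomial bound for the one-dimensional walk *)

Lemma central_bin_ratio m :
  (m.+1 * 'C(m.+1.*2, m.+1) = 2 * m.*2.+1 * 'C(m.*2, m))%N.
Proof.
have h1 : (m.+1.*2 * 'C(m.*2.+1, m) = m.+1 * 'C(m.+1.*2, m.+1))%N.
  by have := mul_bin_diag m.+1.*2 m; rewrite doubleS.
have h2 : (m.*2.+1 * 'C(m.*2, m) = m.+1 * 'C(m.*2.+1, m))%N.
  by rewrite (mul_bin_down m.*2.+1 m) subSn -addnn ?leq_addr// addnK.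
by rewrite -h1; nia.
Qed.

Lemma central_bin_le m : ('C(m.*2, m) ^ 2 * m.*2.+1 <= 4 ^ m.*2)%N.
Proof.
elim: m => [|m IH]; first by rewrite bin0.
have r := central_bin_ratio m.
rewrite doubleS !(expnS 4).
rewrite -(@leq_pmul2l (m.+1 ^ 2)) ?expn_gt0//.
have -> : (m.+1 ^ 2 * ('C(m.*2.+2, m.+1) ^ 2 * m.*2.+3) =
  (m.+1 * 'C(m.*2.+2, m.+1)) ^ 2 * m.*2.+3)%N by ring.
rewrite -doubleS r.
move: IH; set C := 'C(_, _); set D := expn 4 _.
rewrite -!muln2 !expnMn => IH.
have := leq_mul (leqnn (4 * (m * 2).+1 * (m * 2).+3)%N) IH.
have : (4 * (m * 2).+1 * (m * 2).+3 <= 16 * m.+1 ^ 2)%N by lia.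
move=> /(leq_mul)/(_ (leqnn D)).
move=> a b; have := leq_trans b a; rewrite !mulnA.
by congr (_ <= _)%N; ring.
Qed.

(** Moving away from the central coefficient [a = b], each unit increase of [b]
    multiplies the left side by [(a + b + 1)(a + b + 2) / (b + 1)^2 <= 4]. *)
Lemma bin_sqr_le a b : (a <= b)%N ->
  ('C(a + b, a) ^ 2 * (a + b).+1 <= 4 ^ (a + b))%N.
Proof.
move=> ab; rewrite -(subnKC ab); move: (b - a)%N => k {b ab}.
elim: k => [|k IH]; first by rewrite addn0 addnn; exact: central_bin_le.
have r : ((a + k).+1 * 'C((a + (a + k)).+1, a) =
   (a + (a + k)).+1 * 'C(a + (a + k), a))%N.
  by rewrite (mul_bin_down (a + (a + k)).+1 a); congr (_ * _)%N; lia.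
rewrite !addnS (expnS 4).
rewrite -(@leq_pmul2l ((a + k).+1 ^ 2)) ?expn_gt0//.
rewrite mulnA -expnMn r.
move: IH; set C := 'C(_, _); set D := expn 4 _ => IH.
have h : ((a + (a + k)).+1 * (a + (a + k)).+2 <= 4 * (a + k).+1 ^ 2)%N by nia.
have := leq_mul h IH.
rewrite (mulnCA _ 4) expnMn [in X in _ -> X]mulnA.
by congr (_ <= _)%N; ring.
Qed.

Lemma bin_sqr_bound n j : ('C(n, j) ^ 2 * n.+1 <= 4 ^ n)%N.
Proof.
have [nj|jn] := ltnP n j; first by rewrite bin_small.
have [h|h] := leqP j (n - j).
  by have := bin_sqr_le h; rewrite subnKC.
by have := bin_sqr_le (ltnW h); rewrite subnK// bin_sub.
Qed.

Section line.
Context {R : realType}.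
Implicit Types (n : nat) (z : int).

(** The law at time [n] of the nearest-neighbour walk on the integers. *)
Fixpoint line_law n z : R :=
  if n is m.+1 then (line_law m (z - 1) + line_law m (z + 1)) / 2
  else (z == 0)%:R.

Lemma line_lawS n x y z : x = z - 1 -> y = z + 1 ->
  line_law n.+1 z = (line_law n x + line_law n y) / 2.
Proof. by move=> -> ->. Qed.

Lemma line_law0 z : z <> 0 -> line_law 0 z = 0.
Proof. by move=> /eqP/negbTE /= ->. Qed.

Lemma line_law_odd n z : line_law n (z * 2 + 1 - n%:Z) = 0.
Proof.
elim: n z => [|n IH] z.
  by rewrite line_law0//; lia.
rewrite (@line_lawS _ ((z - 1) * 2 + 1 - n%:Z) (z * 2 + 1 - n%:Z)); [|lia|lia].
by rewrite !IH addr0 mul0r.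
Qed.

Lemma line_law_out n (j : nat) : line_law n (- n%:Z - (j.+1 * 2)%:Z) = 0.
Proof.
elim: n j => [|n IH] j.
  by rewrite line_law0//; lia.
rewrite (@line_lawS _ (- n%:Z - (j.+2 * 2)%:Z) (- n%:Z - (j.+1 * 2)%:Z)); [|lia|lia].
by rewrite !IH addr0 mul0r.
Qed.

Lemma line_law_bin n (j : nat) :
  line_law n ((j * 2)%:Z - n%:Z) = 'C(n, j)%:R / 2 ^+ n.
Proof.
elim: n j => [|n IH] j.
  by rewrite bin0n expr0 divr1; case: j => [|j] //; rewrite line_law0//; lia.
case: j => [|j].
  rewrite (@line_lawS _ (- n%:Z - (1 * 2)%:Z) ((0 * 2)%:Z - n%:Z)); [|lia|lia].
  by rewrite line_law_out IH !bin0 add0r exprSr invfM mulrA.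
rewrite (@line_lawS _ ((j * 2)%:Z - n%:Z) ((j.+1 * 2)%:Z - n%:Z)); [|lia|lia].
by rewrite !IH binS natrD exprSr; field; rewrite expf_neq0.
Qed.

(** The square makes the bound rational: it says that the heat kernel in
    dimension one is at most [n^(-1/2)], and products over coordinates can be
    averaged exactly in this form. *)
Lemma line_law_sqr_le n z : line_law n z ^+ 2 <= n.+1%:R^-1.
Proof.
have [h | [j ->]] : line_law n z = 0 \/
    exists j : nat, z = (j * 2)%:Z - n%:Z.
- have [k [->|->]] : exists k : int, z = k * 2 + 1 - n%:Z \/ z = k * 2 - n%:Z.
    exists ((z + n%:Z) %/ 2)%Z.
    by have := divz_eq (z + n%:Z) 2; have := modz_ge0 (z + n%:Z) (isT : 2 != 0 :> int);
       have := ltz_mod (z + n%:Z) (isT : 2 != 0 :> int); lia.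
    by left; exact: line_law_odd.
  case: k => [k|k]; first by right; exists k.
  left; rewrite -(line_law_out n k); congr line_law; rewrite NegzE; lia.
- by rewrite h expr0n/= invr_ge0 ler0n.
rewrite line_law_bin expr_div_n ler_pdivrMr ?exprn_gt0//.
rewrite mulrC ler_pdivlMr ?ltr0n//.
have := bin_sqr_bound n j; rewrite -(ler_nat R) natrM !natrX.
by rewrite -exprM mulnC exprM (_ : 2 ^+ 2 = 4)//; ring.
Qed.

End line.

(** * Averages over finite words *)

Section word_mean.
Context {R : realType} {A : finType}.
Implicit Types (F G : seq A -> R).

(** Expectation over [k] independent uniform letters. The recursion conditions on
    the first letter, which is how the Markov property of the walk is used. *)
Fixpoint word_mean k F : R :=
  if k is m.+1 then #|A|%:R^-1 * \sum_a word_mean m (fun u => F (a :: u))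
  else F [::].

Lemma word_meanS k F : word_mean k.+1 F =
  #|A|%:R^-1 * \sum_a word_mean k (fun u => F (a :: u)).
Proof. by []. Qed.

Lemma word_mean_le k F G : (forall u, size u = k -> F u <= G u) ->
  word_mean k F <= word_mean k G.
Proof.
elim: k F G => [|k IH] F G FG /=; first exact: FG.
rewrite ler_wpM2l ?invr_ge0//; apply: ler_sum => a _.
by apply: IH => u su; apply: FG; rewrite /= su.
Qed.

Lemma eq_word_mean k F G : (forall u, size u = k -> F u = G u) ->
  word_mean k F = word_mean k G.
Proof.
by move=> FG; apply/eqP; rewrite eq_le !word_mean_le// => u /FG ->.
Qed.

Lemma word_meanD k F G :
  word_mean k (fun u => F u + G u) = word_mean k F + word_mean k G.
Proof.
elim: k F G => [|k IH] F G //=.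
by rewrite -mulrDr -big_split/=; congr (_ * _); apply: eq_bigr => a _.
Qed.

Lemma word_meanZ k c F : word_mean k (fun u => c * F u) = c * word_mean k F.
Proof.
elim: k F => [|k IH] F //=.
rewrite mulrCA [in RHS]mulr_sumr; congr (_ * _).
by apply: eq_bigr => a _.
Qed.

Lemma word_mean_sum k (I : Type) (s : seq I) (F : I -> seq A -> R) :
  word_mean k (fun u => \sum_(i <- s) F i u) =
  \sum_(i <- s) word_mean k (F i).
Proof.
elim: s => [|i s IH].
  rewrite big_nil -[RHS](mul0r (word_mean k (fun=> 0))) -word_meanZ.
  by apply: eq_word_mean => u _; rewrite big_nil mul0r.
rewrite big_cons -IH -word_meanD.
by apply: eq_word_mean => u _; rewrite big_cons.
Qed.

Lemma word_mean_cst k c : (0 < #|A|)%N -> word_mean k (fun=> c) = c.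
Proof.
move=> A0; elim: k => [|k IH] //=.
rewrite IH sumr_const -[c *+ _]mulr_natl mulrA mulVf ?mul1r//.
by rewrite pnatr_eq0 -lt0n.
Qed.

Lemma word_mean_ge0 k F : (forall u, 0 <= F u) -> 0 <= word_mean k F.
Proof.
move=> F0; elim: k F F0 => [|k IH] F F0 //=.
by rewrite mulr_ge0// ?invr_ge0// sumr_ge0// => a _; exact: IH.
Qed.

(** Size biasing: a word weighted by its number of letters [j] is a word one
    letter shorter with a [j] inserted. *)
Lemma word_mean_count k (j : A) F :
  (forall u v, perm_eq u v -> F u = F v) ->
  word_mean k.+1 (fun u => (count_mem j u)%:R * F u) =
  k.+1%:R / #|A|%:R * word_mean k (fun u => F (j :: u)).
Proof.
elim: k F => [|k IH] F FP.
  rewrite /= (bigD1 j)//= big1 ?addr0; last first.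
    by move=> i ij; rewrite (negbTE ij) mul0r.
  by rewrite eqxx/= mul1r div1r.
rewrite [LHS]word_meanS.
have E i : word_mean k.+1 (fun u => (count_mem j (i :: u))%:R * F (i :: u)) =
    (i == j)%:R * word_mean k.+1 (fun u => F (i :: u)) +
    k.+1%:R / #|A|%:R * word_mean k (fun u => F [:: i, j & u]).
  rewrite -(IH (fun u => F (i :: u))); last first.
    by move=> u v uv; apply: FP; rewrite perm_cons.
  rewrite -word_meanZ -word_meanD.
  by apply: eq_word_mean => u _; rewrite /= natrD mulrDl.
rewrite (eq_bigr _ (fun i _ => E i)).
have pick (X : A -> R) : \sum_i (i == j)%:R * X i = X j.
  rewrite (bigD1 j)//= eqxx mul1r big1 ?addr0// => i ij.
  by rewrite (negbTE ij) mul0r.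
rewrite big_split pick -mulr_sumr.
have -> : \sum_i word_mean k (fun u => F [:: i, j & u]) =
          \sum_i word_mean k (fun u => F [:: j, i & u]).
  apply: eq_bigr => i _; apply: eq_word_mean => u _; apply: FP.
  by rewrite -cat1s -(cat1s j (i :: u)) -!(cat1s _ u) !catA perm_cat2r perm_catC.
have A0 : #|A|%:R != 0 :> R by rewrite pnatr_eq0 -lt0n; apply/card_gt0P; exists j.
rewrite word_meanS -[k.+2]addn1 -[k.+1]addn1 !natrD; set S := \sum_a _.
by rewrite /=; field; exact: A0.
Qed.

(** The counts of distinct letters are all of order [k / #|A|]. Letters are
    removed one at a time: by size biasing, an average over words of length [k]
    that contains the factor [1 / (1 + count j)] is at most [#|A| / (k + 1)]
    times the average over words of length [k + 1] without that factor. *)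
Lemma word_mean_prod_count k (s : seq A) : uniq s ->
  word_mean k (fun u => \prod_(j <- s) (count_mem j u).+1%:R^-1) <=
  (#|A|%:R / k.+1%:R) ^+ size s.
Proof.
elim: s k => [|j s IH] k /=.
  move=> _; rewrite expr0; case: (posnP #|A|) => [A0|A0]; last first.
    by rewrite (eq_word_mean (G := fun=> 1)) ?word_mean_cst// => u _; rewrite big_nil.
  case: k => [|k] /=; first by rewrite big_nil.
  by rewrite A0 invr0 mul0r.
move=> /andP[js us].
have A0 : 0 < #|A|%:R :> R by rewrite ltr0n; apply/card_gt0P; exists j.
pose F (u : seq A) : R :=
  (count_mem j u)%:R^-1 * \prod_(i <- s) (count_mem i u).+1%:R^-1.
have FP u v : perm_eq u v -> F u = F v.
  move=> /permP uv; rewrite /F uv; congr (_ * _).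
  by apply: eq_bigr => i _; rewrite uv.
have -> : word_mean k (fun u => \prod_(j0 <- j :: s) (count_mem j0 u).+1%:R^-1) =
          word_mean k (fun u => F (j :: u)).
  apply: eq_word_mean => u _; rewrite big_cons /F /= eqxx add1n.
  congr (_ * _); rewrite !big_seq; apply: eq_bigr => i si.
  by rewrite (_ : j == i = false)//; apply: contraNF js => /eqP ->.
have h := word_mean_count k j FP.
rewrite -(@ler_pM2l _ (k.+1%:R / #|A|%:R)) ?divr_gt0// -h exprS mulrA.
rewrite (_ : k.+1%:R / _ * _ = 1) ?mul1r; last first.
  by rewrite -(invf_div #|A|%:R) mulVf// gt_eqF// divr_gt0.
apply: (@le_trans _ _ (word_mean k.+1
   (fun u => \prod_(i <- s) (count_mem i u).+1%:R^-1))).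
  apply: word_mean_le => u _; rewrite /F mulrA ler_piMl//.
    by apply: prodr_ge0 => i _; rewrite invr_ge0.
  have [->|c0] := posnP (count_mem j u); first by rewrite mul0r.
  by rewrite mulfV// pnatr_eq0 -lt0n.
apply: le_trans (IH _ us) _.
rewrite lerXn2r ?nnegrE ?divr_ge0// ler_pM2l// lef_pV2 ?posrE ?ltr0n//.
by rewrite ler_nat.
Qed.

End word_mean.

(** * Heat kernel and Green function of the walk *)

(** Cauchy-Schwarz for a bound [H] on the square, in the linear form
    [F <= D / 2 + F^2 / (2 D)], which needs only positivity of the average. *)
Lemma word_mean_sqr (R : realType) (A : finType) k (F H : seq A -> R) (D : R) :
  (0 < #|A|)%N -> 0 < D ->
  (forall u, F u ^+ 2 <= H u) -> word_mean k H <= D ^+ 2 -> word_mean k F <= D.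
Proof.
move=> A0 D0 FH HD.
apply: (@le_trans _ _ (word_mean k (fun u => D / 2 + (2 * D)^-1 * H u))).
  apply: word_mean_le => u _.
  have D2 : 0 < 2 * D by rewrite mulr_gt0.
  rewrite -(ler_pM2l D2) mulrDr mulVKf ?gt_eqF//.
  rewrite -lerBlDl; apply: le_trans (FH u).
  have -> : 2 * D * F u - 2 * D * (D / 2) = F u ^+ 2 - (F u - D) ^+ 2 by field.
  by rewrite gerBl sqr_ge0.
rewrite word_meanD (word_meanZ k _ H) word_mean_cst//.
apply: (@le_trans _ _ (D / 2 + (2 * D)^-1 * D ^+ 2)).
  by rewrite lerD2l ler_wpM2l// invr_ge0 mulr_ge0// ltW.
by rewrite le_eqVlt; apply/orP; left; apply/eqP; field; rewrite gt_eqF.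
Qed.

Lemma mean_cst (R : realType) (A : finType) (c : R) : (0 < #|A|)%N ->
  #|A|%:R^-1 * \sum_(a : A) c = c.
Proof. by move=> A0; exact: (@word_mean_cst _ A 1 c A0). Qed.

Section walk.
Context {R : realType} {d : nat}.
Local Notation letter := ('I_d * bool)%type.
Implicit Types (u : seq letter) (B : seq (lattice d)) (x w : lattice d).

Definition unit_step (a : letter) : lattice d := (-1) ^+ a.2 *: delta_mx 0 a.1.

Definition endpoint u : lattice d := \sum_(a <- u) unit_step a.

Lemma endpoint_cons a u : endpoint (a :: u) = unit_step a + endpoint u.
Proof. by rewrite /endpoint big_cons. Qed.

(** A step chooses a coordinate and a sign. Given the chosen coordinates, the
    coordinates of the endpoint are independent one-dimensional walks, run for
    as many steps as their coordinate was chosen. *)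
Lemma endpoint_law k w :
  word_mean k (fun u => (endpoint u == w)%:R) =
  word_mean k (fun v : seq 'I_d => \prod_i line_law (count_mem i v) (w 0 i)) :> R.
Proof.
elim: k w => [|k IH] w.
  rewrite /= /endpoint big_nil; case: eqP => [<-|w0].
    by rewrite big1// => i _; rewrite mxE.
  have [i wi] : exists i, w 0 i != 0.
    apply/existsP; rewrite -negb_forall; apply/negP => /forallP h; apply: w0.
    by apply/rowP => i; rewrite mxE; apply/esym/eqP.
  by rewrite (bigD1 i)//= (negbTE wi) mul0r.
rewrite !word_meanS card_prod card_bool natrM invfM -mulrA; congr (_ * _).
have -> (f : letter -> R) : \sum_a f a = \sum_i (f (i, true) + f (i, false)).
  transitivity (\sum_i \sum_b f (i, b)).
    by rewrite pair_bigA; apply: eq_bigr => -[].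
  by apply: eq_bigr => i _; rewrite big_bool.
rewrite mulr_sumr.
apply: eq_bigr => i _.
have E b : word_mean k (fun u => (endpoint ((i, b) :: u) == w)%:R) =
    word_mean k (fun v : seq 'I_d =>
      line_law (count_mem i v) (w 0 i - (-1) ^+ b) *
      \prod_(j | j != i) line_law (count_mem j v) (w 0 j)) :> R.
  rewrite (eq_word_mean (G := fun u => (endpoint u == w - unit_step (i, b))%:R)).
    rewrite IH; apply: eq_word_mean => v _; rewrite (bigD1 i)//=; congr (_ * _).
      by rewrite !mxE !eqxx mulr1.
    by apply: eq_bigr => j ji; rewrite !mxE eqxx (negbTE ji) mulr0 subr0.
  by move=> u _; rewrite endpoint_cons [in RHS]eq_sym subr_eq eq_sym addrC.
rewrite !E /= -word_meanD -word_meanZ.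
apply: eq_word_mean => v _; rewrite [RHS](bigD1 i)//= ?eqxx ?add1n /=.
rewrite expr1 expr0 opprK -mulrDl mulrA /=.
rewrite (_ : \prod_(j | j != i) line_law ((i == j) + count_mem j v) (w 0 j) =
  \prod_(j | j != i) line_law (count_mem j v) (w 0 j)); last first.
  by apply: eq_bigr => j ji; rewrite eq_sym (negbTE ji) add0n.
by congr (_ * _); rewrite mulrC addrC.
Qed.

(** With [b = (d / (k + 1))^(d/2)] this is the on-diagonal decay [k^(-d/2)] of the
    heat kernel; the hypothesis is squared to avoid half-integer powers. *)
Lemma heat_kernel_sqr k w (b : R) : (0 < d)%N -> 0 < b ->
  (d%:R / k.+1%:R) ^+ d <= b ^+ 2 ->
  word_mean k (fun u => (endpoint u == w)%:R) <= b.
Proof.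
move=> d0 b0 db; rewrite endpoint_law.
apply: (@word_mean_sqr _ _ _ _
  (fun v => \prod_(i <- index_enum 'I_d) (count_mem i v).+1%:R^-1)) => //.
- by rewrite card_ord.
- move=> v; rewrite -prodrXl; apply: ler_prod => i _.
  by rewrite sqr_ge0 line_law_sqr_le.
- apply: le_trans (word_mean_prod_count _ (index_enum_uniq _)) _.
  by rewrite card_ord -[index_enum _]enumT size_enum_ord.
Qed.

(** Number of visits to [B], time 0 included, of the path started at [x]. *)
Fixpoint hits B x u : nat :=
  ((x \in B) + if u is a :: v then hits B (x + unit_step a)%R v else 0)%N.

Lemma mean_hits B x n : (0 < d)%N ->
  word_mean n (fun u => (hits B x u)%:R) =
  \sum_(k < n.+1) word_mean k (fun u => (x + endpoint u \in B)%:R) :> R.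
Proof.
move=> d0; elim: n x => [|n IH] x.
  by rewrite big_ord1 /= /endpoint big_nil addr0 addn0.
rewrite word_meanS big_ord_recl /= /endpoint big_nil addr0.
have c0 : (0 < #|{: letter}|)%N by rewrite card_prod card_ord card_bool muln_gt0 d0.
have E a : word_mean n (fun u => ((x \in B) + hits B (x + unit_step a)%R u)%N%:R) =
    (x \in B)%:R + \sum_(k < n.+1)
      word_mean k (fun u => (x + endpoint (a :: u) \in B)%:R) :> R.
  rewrite (eq_word_mean (G := fun u => (x \in B)%:R + (hits B (x + unit_step a) u)%:R)).
    rewrite word_meanD word_mean_cst// IH; congr (_ + _).
    by apply: eq_bigr => k _; apply: eq_word_mean => u _; rewrite endpoint_cons addrA.
  by move=> u _; rewrite natrD.
rewrite (eq_bigr _ (fun a _ => E a)) big_split/= mulrDr; congr (_ + _).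
  by rewrite mean_cst.
by rewrite exchange_big/= mulr_sumr.
Qed.

(** The terms are at most [min 1 (r / k)^(3/2)], whose sum is of order [r]: at
    most [r] terms are not controlled by the power, and beyond [r] the tail
    telescopes against [2 r (r / k)^(1/2)]. This is where transience, an exponent
    larger than 1, is used. *)
Lemma sum_three_halves (r : R) (a : nat -> R) n : 0 < r ->
  (forall k, 0 <= a k <= 1) ->
  (forall k, r <= k.+1%:R -> a k ^+ 2 <= (r / k.+1%:R) ^+ 3) ->
  \sum_(k < n) a k <= 3 * r + 1.
Proof.
move=> r0 a01 ar.
have triv m : \sum_(k < m) a k <= m%:R.
  elim: m => [|m IH]; first by rewrite big_ord0.
  by rewrite big_ord_recr/= -natr1 lerD//; have /andP[] := a01 m.
suff H m : r <= m.+1%:R ->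
    \sum_(k < m.+1) a k <= 3 * r + 1 - 2 * r * Num.sqrt (r / m.+1%:R).
  have [nr|rn] := ltP n%:R r.
    by apply: le_trans (triv n) _; lra.
  case: n rn => [|m] rn; first by rewrite big_ord0; lra.
  apply: le_trans (H _ rn) _; rewrite gerBl.
  by rewrite mulr_ge0// ?sqrtr_ge0// mulr_ge0// ltW.
have sq_le1 j : r <= j.+1%:R -> Num.sqrt (r / j.+1%:R) <= 1.
  move=> rj; rewrite -[leRHS]sqrtr1 ler_wsqrtr// ler_pdivrMr ?ltr0n//.
  by rewrite mul1r.
have base j : j%:R <= r -> r <= j.+1%:R ->
    \sum_(k < j.+1) a k <= 3 * r + 1 - 2 * r * Num.sqrt (r / j.+1%:R).
  move=> jr rj; apply: le_trans (triv _) _; have := sq_le1 _ rj.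
  have := sqrtr_ge0 (r / j.+1%:R); rewrite -natr1; nra.
elim: m => [|m IH] rm; first by apply: base => //; exact: ltW.
have [mr|mr] := ltP m.+1%:R r; first by apply: base => //; exact: ltW.
rewrite big_ord_recr/=; apply: le_trans (lerD (IH mr) (lexx _)) _.
set p := Num.sqrt _; set q := Num.sqrt _.
have M0 : 0 < m.+1%:R :> R by rewrite ltr0n.
have p0 : 0 < p by rewrite sqrtr_gt0 divr_gt0.
have q0 : 0 < q by rewrite sqrtr_gt0 divr_gt0// ltr0n.
have p2 : p ^+ 2 = r / m.+1%:R by rewrite sqr_sqrtr// divr_ge0// ltW.
have q2 : q ^+ 2 = r / m.+2%:R by rewrite sqr_sqrtr// divr_ge0// ltW.
have qp : q <= p.
  by rewrite ler_wsqrtr// ler_pM2l// lef_pV2 ?posrE ?ltr0n// ler_nat.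
have aq : a m.+1 <= q ^+ 3.
  have /andP[a0 _] := a01 m.+1.
  rewrite -(@ler_pXn2r _ 2)// ?nnegrE ?exprn_ge0// ?(ltW q0)//.
  by apply: le_trans (ar _ rm) _; rewrite -exprM mulnC exprM q2.
have key : r * (p - q) * (p + q) = p ^+ 2 * q ^+ 2.
  rewrite -mulrA -subr_sqr p2 q2 -[m.+2%:R]natr1.
  by field; rewrite !gt_eqF// addr_gt0.
have : q ^+ 3 <= 2 * (r * (p - q)).
  rewrite -(@ler_pM2r _ (p + q)) ?addr_gt0//.
  have -> : 2 * (r * (p - q)) * (p + q) = q ^+ 2 * (2 * p ^+ 2).
    by rewrite -mulrA key; ring.
  have -> : q ^+ 3 * (p + q) = q ^+ 2 * (q * (p + q)) by ring.
  by rewrite ler_pM2l ?exprn_gt0//; nra.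
move: aq; lra.
Qed.

(** At time [k] the walk is in [B] with probability at most
    [min 1 (size B (d / k)^(d/2))]. With [r = d (size B)^(2/d)] the second bound
    is [(r / k)^(d/2)], hence at most [(r / k)^(3/2)] once it is below 1. *)
Lemma green_bound B x n : (3 <= d)%N -> (0 < size B)%N ->
  word_mean n (fun u => (hits B x u)%:R) <=
  4 * d%:R * (size B)%:R `^ (2 / d%:R) :> R.
Proof.
move=> d3 B0; have d0 : (0 < d)%N by apply: leq_trans d3.
have c0 : (0 < #|{: letter}|)%N by rewrite card_prod card_ord card_bool muln_gt0 d0.
rewrite mean_hits//; set b := (size B)%:R : R.
have b1 : 1 <= b by rewrite ler1n.
have b0 : 0 < b by apply: lt_le_trans b1.
set r := d%:R * b `^ (2 / d%:R).
have bd : (b `^ (2 / d%:R)) ^+ d = b ^+ 2.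
  rewrite -powR_mulrn ?powR_ge0// -powRrM divfK ?pnatr_eq0 -?lt0n//.
  by rewrite powR_mulrn// ltW.
have pb1 : 1 <= b `^ (2 / d%:R) by rewrite -[leLHS](powRr0 b) ler_powR// divr_ge0.
have d1 : 1 <= d%:R :> R by rewrite ler1n.
have r1 : 1 <= r by rewrite -[leLHS]mulr1 ler_pM.
have r0 : 0 < r by apply: lt_le_trans r1.
apply: (@le_trans _ _ (3 * r + 1)); last by rewrite -mulrA -/r; lra.
apply: (@sum_three_halves r
  (fun k => word_mean k (fun u => (x + endpoint u \in B)%:R))) => // k.
  rewrite word_mean_ge0//= -[leRHS](word_mean_cst (A := letter) k 1 c0).
  by apply: word_mean_le => u _; rewrite lern1 leq_b1.
move=> rk; set t := r / k.+1%:R.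
have t0 : 0 < t by rewrite divr_gt0.
have t1 : t <= 1 by rewrite ler_pdivrMr ?ltr0n// mul1r.
have h0 : 0 <= word_mean k (fun u => (x + endpoint u \in B)%:R) :> R.
  exact: word_mean_ge0.
suff h : word_mean k (fun u => (x + endpoint u \in B)%:R) <= Num.sqrt (t ^+ d) :> R.
  apply: (@le_trans _ _ (t ^+ d)); last by rewrite ler_wiXn2l// ltW.
  rewrite -[leRHS]sqr_sqrtr ?exprn_ge0 ?(ltW t0)//.
  by rewrite lerXn2r// nnegrE sqrtr_ge0.
apply: (@le_trans _ _ (\sum_(z <- B)
    word_mean k (fun u => (endpoint u == z - x)%:R))).
  rewrite -word_mean_sum; apply: word_mean_le => u _.
  have [xB|_] := boolP (_ \in _); last by rewrite sumr_ge0.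
  by rewrite (big_rem _ xB)/= [x + _ - x]addrAC subrr add0r eqxx lerDl sumr_ge0.
apply: (@le_trans _ _ (\sum_(z <- B) (Num.sqrt (t ^+ d) / b))).
  apply: ler_sum => z _; apply: heat_kernel_sqr => //.
    by rewrite divr_gt0// sqrtr_gt0 exprn_gt0.
  rewrite [leRHS]expr_div_n sqr_sqrtr ?exprn_ge0 ?(ltW t0)// -bd -expr_div_n.
  suff -> : t / b `^ (2 / d%:R) = d%:R / k.+1%:R by [].
  by rewrite /t /r mulrAC mulfK// gt_eqF// powR_gt0.
rewrite big_const_seq count_predT iter_addr_0 -[_ *+ _]mulr_natl -/b.
by rewrite mulrCA divff ?mulr1// gt_eqF.
Qed.

(** Splitting [exp (th hits)] at each visit bounds the exponential moment by
    [1 + (exp th - 1) G] times the supremum of the exponential moments for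
    shorter times, and a supremum equal to 2 is self-consistent. *)
Lemma khasminskii B (G th : R) : (0 < d)%N -> 0 <= th ->
  (forall n x, word_mean n (fun u => (hits B x u)%:R) <= G) ->
  (expR th - 1) * G <= 1 / 2 ->
  forall n x, word_mean n (fun u => expR (th * (hits B x u)%:R)) <= 2.
Proof.
move=> d0 th0 HG hG.
have c0 : (0 < #|{: letter}|)%N by rewrite card_prod card_ord card_bool muln_gt0 d0.
have e1 : 0 <= expR th - 1 by rewrite subr_ge0 -expR0 ler_expR.
set e := expR th - 1 in hG e1.
suff H n x : word_mean n (fun u => expR (th * (hits B x u)%:R)) <=
    1 + e * 2 * word_mean n (fun u => (hits B x u)%:R).
  move=> n x; apply: le_trans (H n x) _.
  have : e * word_mean n (fun u => (hits B x u)%:R) <= 1 / 2.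
    by apply: le_trans hG; rewrite ler_wpM2l.
  lra.
have stepE y : expR (th * (y \in B)%:R) = 1 + e * (y \in B)%:R.
  by case: (y \in B); rewrite ?mulr1 ?mulr0 ?expR0 /e; ring.
elim: n x => [|n IH] x.
  by rewrite /= !addn0 stepE lerD2l ler_wpM2r// ?ler0n//; lra.
rewrite !word_meanS.
apply: (@le_trans _ _ (#|{: letter}|%:R^-1 * \sum_(a : letter)
   (1 + e * 2 * word_mean n (fun u => (hits B x (a :: u))%:R)))); last first.
  rewrite big_split/= mulrDr mean_cst//.
  by rewrite lerD2l -mulr_sumr mulrCA.
rewrite ler_wpM2l ?invr_ge0//; apply: ler_sum => a _.
set y := x + unit_step a.
set U := word_mean n (fun u => expR (th * (hits B y u)%:R)).
set g := word_mean n (fun u => (hits B y u)%:R : R).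
have -> : word_mean n (fun u => expR (th * (hits B x (a :: u))%:R)) =
          (1 + e * (x \in B)%:R) * U.
  rewrite -word_meanZ; apply: eq_word_mean => u _.
  by rewrite /= natrD mulrDr expRD stepE.
have -> : word_mean n (fun u => (hits B x (a :: u))%:R) = (x \in B)%:R + g.
  rewrite -[X in X + _](word_mean_cst (A := letter) n _ c0) -word_meanD.
  by apply: eq_word_mean => u _; rewrite /= natrD.
have Ug : U <= 1 + e * 2 * g by exact: IH.
have U2 : U <= 2.
  have : e * g <= 1 / 2 by apply: le_trans hG; rewrite ler_wpM2l// HG.
  by move: Ug; lra.
case: (x \in B) => /=; last by rewrite !mulr0 !add0r addr0 mul1r.
have : e * U <= e * 2 by rewrite ler_wpM2l.
by move: Ug; lra.
Qed.

(** Markov's inequality with a parameter [th] of order [1 / G], as large as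
    [khasminskii] allows up to a constant. *)
Lemma hits_tail B n x (t : R) : (3 <= d)%N -> (0 < size B)%N ->
  word_mean n (fun u => (t < (hits B x u)%:R)%R%:R) <=
  2 * expR (- t / (16 * d%:R * (size B)%:R `^ (2 / d%:R))).
Proof.
move=> d3 B0; have d0 : (0 < d)%N by apply: leq_trans d3.
set G := 4 * d%:R * (size B)%:R `^ (2 / d%:R) : R.
have G1 : 1 <= G.
  have b1 : 1 <= (size B)%:R :> R by rewrite ler1n.
  have pb1 : 1 <= (size B)%:R `^ (2 / d%:R) :> R.
    by rewrite -[leLHS](powRr0 (size B)%:R) ler_powR// divr_ge0.
  have d1 : 1 <= d%:R :> R by rewrite ler1n.
  by rewrite /G; nra.
have G0 : 0 < G by apply: lt_le_trans G1.
set th := (4 * G)^-1.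
have th0 : 0 < th by rewrite invr_gt0 mulr_gt0.
have th4 : th <= 1 / 4.
  by rewrite /th invfM div1r ler_piMr// invf_le1.
have eth : expR th - 1 <= 2 * th.
  have := expR_ge1Dx (- th); rewrite expRN => h.
  have e0 := expR_gt0 th.
  have : (1 - th) * expR th <= 1.
    by rewrite -ler_pdivlMr// div1r.
  move: th4; nra.
have K := @khasminskii B G th d0 (ltW th0) (fun n x => green_bound x n d3 B0).
have {K} K : word_mean n (fun u => expR (th * (hits B x u)%:R)) <= 2.
  apply: K; apply: le_trans (ler_wpM2r (ltW G0) eth) _.
  by rewrite /th invfM -!mulrA mulVf ?gt_eqF//; lra.
rewrite (_ : - t / _ = - (th * t)); last first.
  rewrite /th /G -!mulrA mulNr mulrC; congr (- (_^-1 * _)).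
  by rewrite !mulrA; congr (_ * _ * _); lra.
rewrite mulrC; apply: le_trans (ler_wpM2l (expR_ge0 _) K).
rewrite -word_meanZ; apply: word_mean_le => u _; rewrite -expRD.
case: ltP => [h|_]; last exact: expR_ge0.
by rewrite -[leLHS]expR0 ler_expR addrC -mulrBr mulr_ge0// ?subr_ge0 ltW.
Qed.

End walk.

(** * Local times of small sets *)

Section crowding.
Context {R : realType} {d : nat}.
Local Notation letter := ('I_d * bool)%type.
Implicit Types (u : seq letter) (B : seq (lattice d)) (x z : lattice d).

Definition word_path u (k : nat) : lattice d := endpoint (take k u).

Lemma hitsE B x u :
  hits B x u = (\sum_(k < (size u).+1) ((x + word_path u k)%R \in B))%N.
Proof.
elim: u x => [|a u IH] x /=.
  by rewrite big_ord1 /word_path /endpoint big_nil addr0 addn0.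
have x0 : x + word_path (a :: u) 0 = x by rewrite /word_path /endpoint big_nil addr0.
rewrite IH [RHS]big_ord_recl x0; congr (_ + _)%N; apply: eq_bigr => k _.
by rewrite /word_path /= endpoint_cons addrA.
Qed.

Lemma sum_local_time (s : nat -> lattice d) n B : uniq B ->
  (\sum_(z <- B) local_time s n z = \sum_(k < n.+1) (s k \in B))%N.
Proof.
move=> uB; rewrite exchange_big/=; apply: eq_bigr => k _.
rewrite -(count_uniq_mem _ uB) -sum1_count [RHS]big_mkcond/=.
by apply: eq_bigr => z _; rewrite eq_sym; case: eqP.
Qed.

Lemma norm_endpoint u i : `|endpoint u 0 i| <= (size u)%:Z.
Proof.
elim: u => [|a u IH]; first by rewrite /endpoint big_nil mxE.
rewrite endpoint_cons !mxE (le_trans (ler_normD _ _))//= -[(size u).+1]add1n PoszD lerD//.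
by rewrite normrM normr_sign mul1r; case: (i == a.1).
Qed.

Section box.
Variable n : nat.
Local Notation box := {ffun 'I_d -> 'I_n.*2.+1}.

Definition box_point (f : box) : lattice d := \row_i ((f i)%:Z - n%:Z).
Definition box_index z : box := [ffun i => inord `|(z 0 i + n%:Z)%R|%N].

Lemma box_indexK u : (size u <= n)%N ->
  box_point (box_index (endpoint u)) = endpoint u.
Proof.
move=> un; apply/rowP => i; rewrite mxE ffunE inordK.
  by have := norm_endpoint u i; move: (endpoint u 0 i) => z; lia.
by have := norm_endpoint u i; move: (endpoint u 0 i) => z; rewrite -addnn; lia.
Qed.

(** The sets of at most [N] sites are enumerated as the images of [N]-tuples of
    points of a finite box that contains every path of length [n]; repetitions
    in the tuple account for smaller sets. *)
Definition spread N (c : R) u := [forall t : N.-tuple box,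
  (hits (map box_point t) 0 u)%:R <= c].

(** Sites of [B] outside the box are not visited by a path of length [n], and the
    spare entries of the tuple can be filled arbitrarily, since enlarging the
    set only increases the number of visits. *)
Lemma spread_local_time N c u B : size u = n -> spread N c u ->
  uniq B -> (size B <= N)%N ->
  (\sum_(z <- B) local_time (word_path u) n z)%N%:R <= c.
Proof.
move=> un /forallP spr uB BN.
pose t := map box_index B ++ nseq (N - size B) (box_index 0).
have tN : size t == N by rewrite size_cat size_map size_nseq subnKC.
apply: le_trans (spr (Tuple tN)); rewrite ler_nat sum_local_time// hitsE un.
apply: leq_sum => k _; rewrite add0r; case: (boolP (_ \in B)) => // kB.
rewrite lt0b /= map_cat mem_cat -map_comp; apply/orP; left.
apply/mapP; exists (word_path u k) => //=.
by rewrite /word_path box_indexK// size_take un; case: ifP => // /ltnW.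
Qed.

(** Union bound over the [(2n + 1)^(d N)] tuples. *)
Lemma mean_not_spread N c : (3 <= d)%N -> (0 < N)%N ->
  word_mean n (fun u => (~~ spread N c u)%:R) <=
  2 * n.*2.+1%:R ^+ (d * N) * expR (- c / (16 * d%:R * N%:R `^ (2 / d%:R))).
Proof.
move=> d3 N0.
apply: (@le_trans _ _ (\sum_(t : N.-tuple box) word_mean n
   (fun u => (c < (hits (map box_point t) 0 u)%:R)%R%:R))).
  rewrite -word_mean_sum; apply: word_mean_le => u _.
  have [|/forallPn[t]] := boolP (spread _ _ _); first by rewrite sumr_ge0.
  by rewrite -ltNge => ct; rewrite (bigD1 t)//= ct lerDl sumr_ge0.
apply: (@le_trans _ _ (\sum_(t : N.-tuple box)
   2 * expR (- c / (16 * d%:R * N%:R `^ (2 / d%:R))))).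
  apply: ler_sum => t _; have sN : size (map box_point t) = N.
    by rewrite size_map size_tuple.
  by have := @hits_tail R d (map box_point t) n 0 c d3; rewrite sN; apply.
rewrite sumr_const card_tuple card_ffun !card_ord -[_ *+ _]mulr_natl.
by rewrite natrX natrX -exprM mulrCA mulrA.
Qed.

End box.

End crowding.

(** * Expectations of products of independent variables *)

Section decouple.
Context {R : realType} {dX : measure_display} {X : measurableType dX}
  (Q : probability X R).
Local Open Scope ereal_scope.

Import HBNNSimple.

(** Independence of [Y] and [Z], known on indicators of [Z] only, extends to
    nonnegative functions of [Z] by linearity and monotone convergence. *)
Lemma integral_decouple dU (U : measurableType dU)
    (Y : X -> R) (Z : X -> U) (f : U -> R) :
  measurable_fun setT Y -> (forall x, 0 <= Y x)%R -> measurable_fun setT Z ->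
  \int[Q]_x (Y x)%:E < +oo ->
  (forall B, measurable B ->
     \int[Q]_x (Y x * \1_B (Z x))%:E = \int[Q]_x (Y x)%:E * Q (Z @^-1` B)) ->
  measurable_fun setT f -> (forall r, 0 <= f r)%R ->
  \int[Q]_x (Y x * f (Z x))%:E =
    \int[Q]_x (Y x)%:E * \int[Q]_x (f (Z x))%:E.
Proof.
move=> mY Y0 mZ Yfin H mf f0.
have EY0 : 0 <= \int[Q]_x (Y x)%:E by apply: integral_ge0 => x _; rewrite lee_fin.
have mEf : measurable_fun setT (EFin \o f) by exact/measurable_EFinP.
pose g := nnsfun_approx measurableT mEf.
have gf r : (g ^~ r n)%:E @[n --> \oo] --> (f r)%:E.
  by apply: cvg_nnsfun_approx => // s _; rewrite lee_fin.
have ndg r m n : (m <= n)%N -> (g m r <= g n r)%R.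
  by move=> mn; have /lefP := nd_nnsfun_approx measurableT mEf mn; exact.
have mgZ n : measurable_fun setT (g n \o Z) by exact: measurableT_comp.
have simple n : \int[Q]_x (Y x * g n (Z x))%:E =
    \int[Q]_x (Y x)%:E * \int[Q]_x (g n (Z x))%:E.
  have mZ1 r : measurable (Z @^-1` (g n @^-1` [set r])).
    by rewrite -[_ @^-1` _]setTI; exact: mZ.
  have m1 r : measurable_fun setT (fun x => \1_(g n @^-1` [set r]) (Z x) : R).
    exact: measurableT_comp.
  transitivity (\int[Q]_x \sum_(r \in range (g n))
      (r * (Y x * \1_(g n @^-1` [set r]) (Z x)))%:E).
    apply: eq_integral => x _; rewrite fsumEFin//; congr EFin.
    rewrite {1}fimfunE mulr_fsumr//.
    by apply: eq_fsbigr => r _; rewrite mulrCA.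
  have r0 r x : 0 <= (r * (Y x * \1_(g n @^-1` [set r]) (Z x)))%:E.
    rewrite lee_fin indicE; case: (boolP (_ \in _)); last by rewrite !mulr0.
    by rewrite inE /= => <-; rewrite mulr1 mulr_ge0.
  rewrite ge0_integral_fsum//; last first.
    move=> r; apply/measurable_EFinP; apply: measurable_funM => //.
    exact: measurable_funM.
  have -> : \int[Q]_x (g n (Z x))%:E = \sum_(r \in range (g n))
      (r%:E * Q (Z @^-1` (g n @^-1` [set r]))).
    transitivity (\int[Q]_x \sum_(r \in range (g n))
      (r * \1_(g n @^-1` [set r]) (Z x))%:E).
      by apply: eq_integral => x _; rewrite fsumEFin//; congr EFin; rewrite {1}fimfunE.
    have r0' r x : 0 <= (r * \1_(g n @^-1` [set r]) (Z x))%:E.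
      rewrite lee_fin indicE; case: (boolP (_ \in _)); last by rewrite !mulr0.
      by rewrite inE /= => <-; rewrite mulr1.
    rewrite ge0_integral_fsum//; last first.
      by move=> r; apply/measurable_EFinP; exact: measurable_funM.
    apply: eq_fsbigr => r; rewrite inE => -[s _ sr].
    have rr : (0 <= r)%R by rewrite -sr.
    under eq_integral do rewrite EFinM.
    rewrite ge0_integralZl_EFin//; last exact/measurable_EFinP.
    congr (_ * _).
    by have := integral_indic Q measurableT (mZ1 r); rewrite setIT => <-.
  rewrite ge0_mule_fsumr; last first.
    move=> r; have [r0'|r0'] := ltP r 0%R; last by rewrite mule_ge0.
    by rewrite preimage_nnfun0// preimage_set0 measure0 mule0.
  apply: eq_fsbigr => r; rewrite inE => -[s _ sr].
  have rr : (0 <= r)%R by rewrite -sr.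
  under eq_integral do rewrite EFinM.
  rewrite ge0_integralZl_EFin//.
  - by rewrite H// muleCA.
  - by move=> x _; rewrite lee_fin mulr_ge0.
  - by apply/measurable_EFinP; exact: measurable_funM.
have c1 : \int[Q]_x (Y x * g n (Z x))%:E @[n --> \oo] -->
    \int[Q]_x (Y x * f (Z x))%:E.
  rewrite (_ : (fun x => (Y x * f (Z x))%:E) =
    (fun x => limn (fun n => (Y x * g n (Z x))%:E))); last first.
    apply/funext => x; apply/esym/cvg_lim => //.
    rewrite EFinM; under eq_fun do rewrite EFinM.
    by apply: cvgeZl => //; exact: gf.
  apply: cvg_monotone_convergence => //.
  - move=> n; apply/measurable_EFinP; apply: measurable_funM => //; exact: mgZ.
  - by move=> n x _; rewrite lee_fin mulr_ge0.
  - by move=> x _ m n mn; rewrite lee_fin; apply: ler_wpM2l => //; exact: ndg.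
have c2 : \int[Q]_x (g n (Z x))%:E @[n --> \oo] --> \int[Q]_x (f (Z x))%:E.
  rewrite (_ : (fun x => (f (Z x))%:E) =
    (fun x => limn (fun n => (g n (Z x))%:E))); last first.
    apply/funext => x; apply/esym/cvg_lim => //; exact: gf.
  apply: cvg_monotone_convergence => //.
  - by move=> n; apply/measurable_EFinP; exact: mgZ.
  - by move=> n x _; rewrite lee_fin.
  - by move=> x _ m n mn; rewrite lee_fin; exact: ndg.
have c3 : \int[Q]_x (Y x * g n (Z x))%:E @[n --> \oo] -->
    \int[Q]_x (Y x)%:E * \int[Q]_x (f (Z x))%:E.
  rewrite (funext simple).
  by apply: cvgeZl => //; rewrite ge0_fin_numE.
exact: cvg_unique c1 c3.
Qed.

End decouple.

Section independent_product.
Context {R : realType} {dX : measure_display} {X : measurableType dX}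
  (Q : probability X R) {I : choiceType} {dU : measure_display}
  {U : measurableType dU} (xi : I -> X -> U) (f : I -> U -> R) (M : R).
Hypothesis mxi : forall i, measurable_fun setT (xi i).
Hypothesis ind : mutually_independent Q xi.
Hypothesis mf : forall i, measurable_fun setT (f i).
Hypothesis f0 : forall i r, 0 <= f i r.
Hypothesis fM : forall i r, f i r <= M.

(** Interpolates between a product of indicators, for which independence is the
    definition, and a product of the functions [f]: the indicators are replaced
    one by one. *)
Let mixed (s1 s2 : seq I) (B : I -> set U) (x : X) : R :=
  \prod_(i <- s1) f i (xi i x) * \prod_(i <- s2) \1_(B i) (xi i x).

Lemma prod_indic (s : seq I) (B : I -> set U) x :
  \prod_(i <- s) \1_(B i) (xi i x) =
  \1_(\bigcap_(i in [set` [fset i in s]%fset]) (xi i @^-1` B i)) x :> R.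
Proof.
rewrite [RHS]indicE; case: (boolP (x \in _)) => [|/negP]; rewrite inE => H.
  rewrite big_seq big1// => i si; rewrite indicE mem_set//.
  by apply: H; rewrite /= !inE.
have [i si Bi] : exists2 i, i \in s & ~ B i (xi i x).
  apply: contrapT => K; apply: H => i /=; rewrite !inE => si.
  by apply: contrapT => Bi; apply: K; exists i.
by rewrite (big_rem _ si)/= indicE memNset// mul0r.
Qed.

Let measurable_mixed s1 s2 B : (forall i, measurable (B i)) ->
  measurable_fun setT (mixed s1 s2 B).
Proof.
move=> mB; apply: measurable_funM.
  by apply: measurable_prod => i _; exact: measurableT_comp.
apply: measurable_prod => i _; apply: measurableT_comp => //.
Qed.

Let mixed_ge0 s1 s2 B x : 0 <= mixed s1 s2 B x.
Proof. by rewrite mulr_ge0// prodr_ge0. Qed.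

Let mixed_le s1 s2 B x : mixed s1 s2 B x <= M ^+ size s1.
Proof.
rewrite -[leRHS]mulr1 ler_pM ?prodr_ge0//.
  elim: s1 => [|i s IH]; first by rewrite big_nil.
  by rewrite big_cons exprS ler_pM// prodr_ge0.
by rewrite prod_indic indicE lern1 leq_b1.
Qed.

Let integral_mixed s1 s2 B : (forall i, measurable (B i)) -> uniq (s1 ++ s2) ->
  (\int[Q]_x (mixed s1 s2 B x)%:E =
   (\prod_(i <- s1) \int[Q]_x (f i (xi i x))%:E) *
   (\prod_(i <- s2) Q (xi i @^-1` B i)))%E.
Proof.
elim: s1 s2 B => [|j s1 IH] s2 B mB.
  rewrite cat0s => us2; rewrite big_nil mul1e.
  under eq_integral => x _ do rewrite /mixed big_nil mul1r prod_indic.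
  rewrite integral_indic//; last first.
    apply: fin_bigcap_measurable; first exact: finite_fset.
    by move=> i _; rewrite -[_ @^-1` _]setTI; exact: mxi.
  rewrite setIT; apply: etrans (ind [fset i in s2]%fset mB) _; apply: perm_big.
  by apply: uniq_perm => // i; rewrite !inE.
move=> us; have us' : uniq (s1 ++ j :: s2) by rewrite -cat1s uniq_catCA cat1s.
have j1 : j \notin s1 by move: us; rewrite cons_uniq mem_cat negb_or => /andP[/andP[]].
have j2 : j \notin s2 by move: us; rewrite cons_uniq mem_cat negb_or => /andP[/andP[]].
have us12 : uniq (s1 ++ s2) by move: us => /andP[].
transitivity (\int[Q]_x (mixed s1 s2 B x * f j (xi j x))%:E)%E.
  apply: eq_integral => x _; congr EFin; rewrite /mixed big_cons; ring.
rewrite (@integral_decouple _ _ _ _ _ _ (mixed s1 s2 B) (xi j) (f j))//.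
- by rewrite IH// big_cons muleAC; congr (_ * _)%E; exact: muleC.
- exact: measurable_mixed.
- apply: (@le_lt_trans _ _ (\int[Q]_x (cst (M ^+ size s1)%:E x))%E).
    apply: ge0_le_integral => //.
    + by move=> x _; rewrite lee_fin.
    + by apply/measurable_EFinP; exact: measurable_mixed.
    + by move=> x _; rewrite lee_fin; exact: mixed_le.
  by rewrite integral_cst// [X in (_ * X)%E]probability_setT mule1 ltry.
(* The indicator of [A] is absorbed as a new factor attached to [j]. *)
move=> A mA; pose B' i := if i == j then A else B i.
have mB' i : measurable (B' i) by rewrite /B'; case: ifP.
have B'B s (F : I -> set U -> \bar R) : j \notin s ->
    (\prod_(i <- s) F i (B' i) = \prod_(i <- s) F i (B i))%E.
  move=> js; rewrite !big_seq; apply: eq_bigr => i si; rewrite /B' ifF//.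
  by apply: contraNF js => /eqP <-.
have B'Br s x : j \notin s ->
    \prod_(i <- s) \1_(B' i) (xi i x) = \prod_(i <- s) \1_(B i) (xi i x) :> R.
  move=> js; rewrite !big_seq; apply: eq_bigr => i si; rewrite /B' ifF//.
  by apply: contraNF js => /eqP <-.
transitivity (\int[Q]_x (mixed s1 (j :: s2) B' x)%:E)%E.
  apply: eq_integral => x _; congr EFin; rewrite /mixed big_cons B'Br//.
  by rewrite /B' eqxx; ring.
rewrite IH// big_cons (B'B s2 (fun i A => Q (xi i @^-1` A)))// {1}/B' eqxx.
by rewrite IH// muleCA muleC.
Qed.

Lemma integral_prod_independent (s : seq I) : uniq s ->
  (\int[Q]_x (\prod_(i <- s) f i (xi i x))%:E =
   \prod_(i <- s) \int[Q]_x (f i (xi i x))%:E)%E.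
Proof.
move=> us; have := @integral_mixed s [::] (fun=> setT) (fun=> measurableT).
rewrite cats0 big_nil mule1 => <-//.
by apply: eq_integral => x _; rewrite /mixed big_nil mulr1.
Qed.

End independent_product.

(** * Deviations of the scenery for fixed weights *)

Section moments.
Context {R : realType} {d0 : measure_display} {T0 : measurableType d0}
  {P0 : probability T0 R} (xi0 : {RV P0 >-> R}).
Hypothesis xi0_mean : ('E_P0[xi0] = 0)%E.
Hypothesis xi0_moment4 : ('E_P0[fun t => (xi0 t ^+ 4)%R] < +oo)%E.

Definition moment k : R := fine 'E_P0[fun t => (xi0 t ^+ k)%R].

Lemma measurable_pow k : measurable_fun setT (fun t => xi0 t ^+ k).
Proof. exact: measurable_funX. Qed.

Lemma integrable_pow4 : P0.-integrable setT (fun t => (xi0 t ^+ 4)%:E).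
Proof.
apply/integrableP; split; first by apply/measurable_EFinP; exact: measurable_pow.
move: xi0_moment4; rewrite unlock; apply: le_lt_trans.
apply: ge0_le_integral => //.
- by apply: measurableT_comp => //; apply/measurable_EFinP; exact: measurable_pow.
- by apply/measurable_EFinP; exact: measurable_pow.
- by move=> x _; rewrite lee_fin ger0_norm// exprn_even_ge0.
Qed.

Lemma integrable_pow k : (k <= 4)%N ->
  P0.-integrable setT (fun t => (xi0 t ^+ k)%:E).
Proof.
move=> k4; apply: (@le_integrable _ _ _ P0 _ measurableT _
  (fun t => (1 + xi0 t ^+ 4)%:E)).
- by apply/measurable_EFinP; exact: measurable_pow.
- move=> x _; rewrite /= lee_fin normrX [leRHS]ger0_norm; last first.
    by rewrite addr_ge0// exprn_even_ge0.
  have -> : xi0 x ^+ 4 = `|xi0 x| ^+ 4 by rewrite -normrX ger0_norm// exprn_even_ge0.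
  have [h|h] := lerP `|xi0 x| 1.
    by rewrite (le_trans (exprn_ile1 _ (normr_ge0 _) h))// lerDl exprn_ge0.
  by rewrite (le_trans (ler_weXn2l (ltW h) k4))// lerDr.
- under eq_fun do rewrite EFinD.
  apply: integrableD => //; last exact: integrable_pow4.
  exact: finite_measure_integrable_cst.
Qed.

Lemma momentE k : (k <= 4)%N -> (\int[P0]_t (xi0 t ^+ k)%:E = (moment k)%:E)%E.
Proof.
move=> k4; rewrite /moment unlock fineK//.
exact: integrable_fin_num (integrable_pow k4).
Qed.

Lemma moment1 : moment 1 = 0.
Proof. by rewrite /moment (_ : (fun t => _) = xi0) ?xi0_mean//. Qed.

(** Exponential moments are only ever estimated through pointwise polynomial
    bounds; the linear term disappears since the mean vanishes. *)
Lemma mean_poly_le (f : R -> R) (a1 a2 a4 : R) :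
  measurable_fun setT f -> (forall r, 0 <= f r) ->
  (forall r, f r <= 1 + a1 * r + a2 * r ^+ 2 + a4 * r ^+ 4) ->
  (\int[P0]_t (f (xi0 t))%:E <= (1 + (a2 * moment 2 + a4 * moment 4))%:E)%E.
Proof.
move=> mf f0 fle.
have Iz k c : (k <= 4)%N -> P0.-integrable setT (fun t => (c * xi0 t ^+ k)%:E).
  move=> k4; under eq_fun do rewrite EFinM.
  exact/integrableZl/integrable_pow.
have Ez k c : (k <= 4)%N ->
    (\int[P0]_t (c * xi0 t ^+ k)%:E = (c * moment k)%:E)%E.
  move=> k4; under eq_integral do rewrite EFinM.
  by rewrite integralZl//; [rewrite momentE|exact: integrable_pow].
pose p t := (1 * xi0 t ^+ 0 + a1 * xi0 t ^+ 1 + (a2 * xi0 t ^+ 2 + a4 * xi0 t ^+ 4)).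
have I01 : P0.-integrable setT (fun t => (1 * xi0 t ^+ 0 + a1 * xi0 t ^+ 1)%:E).
  by under eq_fun do rewrite EFinD; apply: integrableD => //; exact: Iz.
have I24 : P0.-integrable setT (fun t => (a2 * xi0 t ^+ 2 + a4 * xi0 t ^+ 4)%:E).
  by under eq_fun do rewrite EFinD; apply: integrableD => //; exact: Iz.
have Ip : P0.-integrable setT (fun t => (p t)%:E).
  by rewrite /p; under eq_fun do rewrite EFinD; apply: integrableD.
have Ep : (\int[P0]_t (p t)%:E = (1 + (a2 * moment 2 + a4 * moment 4))%:E)%E.
  rewrite /p; under eq_integral do rewrite EFinD.
  rewrite integralD//.
  under eq_integral do rewrite EFinD.
  rewrite integralD//; [|exact: Iz|exact: Iz].
  under [X in (_ + X)%E]eq_integral do rewrite EFinD.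
  rewrite integralD//; [|exact: Iz|exact: Iz].
  rewrite !Ez// moment1 mulr0 adde0 mul1r -!EFinD; congr (_ + _)%:E.
  have -> : moment 0 = 1; last by [].
  rewrite /moment (_ : (fun t => xi0 t ^+ 0) = cst 1); last first.
    by apply/funext => t; rewrite expr0.
  by rewrite expectation_cst.
rewrite -Ep; apply: ge0_le_integral => //.
- by move=> x _; rewrite lee_fin.
- by apply/measurable_EFinP; exact: measurableT_comp.
- by case/integrableP : Ip.
- by move=> x _; rewrite lee_fin (le_trans (fle _))// /p; lra.
Qed.

End moments.

Section scenery.
Context {R : realType} {d0 : measure_display} {T0 : measurableType d0}
  {P0 : probability T0 R} (xi0 : {RV P0 >-> R}).
Hypothesis xi0_mean : ('E_P0[xi0] = 0)%E.
Hypothesis xi0_moment4 : ('E_P0[fun t => (xi0 t ^+ 4)%R] < +oo)%E.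
Context {dX : measure_display} {X : measurableType dX} {Q : probability X R}
  {I : choiceType} (xi : I -> {RV Q >-> R}).
Hypothesis xi_iid : iid_copies xi xi0.
Local Notation m2 := (moment xi0 2).
Local Notation m4 := (moment xi0 4).

Lemma moment4_ge0 : 0 <= m4.
Proof.
rewrite fine_ge0// unlock; apply: integral_ge0 => t _.
by rewrite lee_fin exprn_even_ge0.
Qed.

Lemma integral_copy i (f : R -> R) : measurable_fun setT f ->
  (forall r, 0 <= f r) ->
  (\int[Q]_x (f (xi i x))%:E = \int[P0]_t (f (xi0 t))%:E)%E.
Proof.
move=> mf f0; have mEf : measurable_fun setT (fun r => (f r)%:E).
  exact/measurable_EFinP.
have Ef0 r : (0 <= (f r)%:E)%E by rewrite lee_fin.
rewrite -(ge0_integral_distribution (xi i) mEf Ef0).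
rewrite -(ge0_integral_distribution xi0 mEf Ef0).
apply: eq_measure_integral => A mA _.
by case: xi_iid => _ /(_ i A mA).
Qed.

(** Markov's inequality for a product of independent factors, each with mean at
    most [1 + a2 m2 + a4 m4 <= exp (a2 m2 + a4 m4)]. *)
Lemma scenery_chernoff (s : seq I) (f : I -> R -> R) (a1 a2 a4 : I -> R)
    (M t : R) (D : set X) :
  uniq s -> (forall i, measurable_fun setT (f i)) ->
  (forall i r, 0 <= f i r) -> (forall i r, f i r <= M) ->
  (forall i r, f i r <= 1 + a1 i * r + a2 i * r ^+ 2 + a4 i * r ^+ 4) ->
  measurable D ->
  (forall x, D x -> expR t <= \prod_(i <- s) f i (xi i x)) ->
  (Q D <= (expR (- t + \sum_(i <- s) (a2 i * m2 + a4 i * m4)))%:E)%E.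
Proof.
move=> us mf f0 fM fle mD HD.
have mprod : measurable_fun setT (fun x => \prod_(i <- s) f i (xi i x)).
  by apply: measurable_prod => i _; exact: measurableT_comp.
have : ((expR t)%:E * Q D <= (expR (\sum_(i <- s) (a2 i * m2 + a4 i * m4)))%:E)%E.
  apply: (@le_trans _ _ (\int[Q]_x (\prod_(i <- s) f i (xi i x))%:E)%E).
    have := integral_indic Q measurableT mD; rewrite setIT => <-.
    rewrite -ge0_integralZl_EFin ?expR_ge0//; last exact/measurable_EFinP.
    apply: ge0_le_integral => //.
    - by apply: measurable_funeM; exact/measurable_EFinP.
    - exact/measurable_EFinP.
    - move=> x _; rewrite -EFinM lee_fin indicE.
      case: (boolP (x \in D)) => [|_]; last by rewrite mulr0 prodr_ge0.
      by rewrite inE mulr1; exact: HD.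
  rewrite (@integral_prod_independent _ _ _ _ _ _ _ (fun i => xi i : X -> R) f M)//.
    pose g i := fine (\int[P0]_t (f i (xi0 t))%:E).
    have gle i := mean_poly_le xi0_mean xi0_moment4 (mf i) (f0 i) (fle i).
    have gge0 i : (0 <= \int[P0]_t (f i (xi0 t))%:E)%E.
      by apply: integral_ge0 => t' _; rewrite lee_fin.
    have gE i : (\int[P0]_t (f i (xi0 t))%:E = (g i)%:E)%E.
      by rewrite fineK// ge0_fin_numE// (le_lt_trans (gle i))// ltry.
    rewrite (eq_bigr (fun i => (g i)%:E)); last first.
      by move=> i _; rewrite integral_copy.
    rewrite prodEFin lee_fin expR_sum; apply: ler_prod => i _.
    rewrite -!lee_fin -gE gge0/=; apply: le_trans (gle i) _.
    by rewrite lee_fin expR_ge1Dx.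
  by case: xi_iid.
by rewrite -lee_pdivlMl ?expR_gt0// expRD expRN EFinM.
Qed.

Lemma expRN_le (u : R) : 0 <= u -> expR (- u) <= 1 - u + u ^+ 2.
Proof.
move=> u0; have h := expR_ge1Dx u.
rewrite expRN -div1r ler_pdivrMr ?expR_gt0//.
have e0 : 0 <= 1 - u + u ^+ 2 by nra.
apply: le_trans (ler_wpM2l e0 h).
have : 0 <= u ^+ 3 by rewrite exprn_ge0.
have -> : (1 - u + u ^+ 2) * (1 + u) = 1 + u ^+ 3 by ring.
by rewrite lerDl.
Qed.

Lemma expR_le_half (u : R) : u <= 1 / 2 -> expR u <= 1 + u + 2 * u ^+ 2.
Proof.
move=> u2; have h := expR_ge1Dx (- u).
have e0 : 0 <= 1 + u + 2 * u ^+ 2 by nra.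
have : 1 <= (1 + u + 2 * u ^+ 2) * expR (- u).
  apply: le_trans (ler_wpM2l e0 h).
  have -> : (1 + u + 2 * u ^+ 2) * (1 - u) = 1 + u ^+ 2 * (1 - 2 * u) by ring.
  by rewrite lerDl mulr_ge0 ?sqr_ge0//; lra.
by rewrite expRN -ler_pdivrMr ?invr_gt0 ?expR_gt0// invrK mul1r.
Qed.

(** Lower deviations of a sum of nonnegative terms are Gaussian as soon as the
    second moments of the terms are finite, from [exp (- u) <= 1 - u + u^2];
    the parameter [t] below optimizes the resulting exponent. *)
Lemma small_scenery_var (s : seq I) (l : I -> R) :
  uniq s -> (forall i, 0 <= l i) -> 0 < \sum_(i <- s) l i ^+ 2 ->
  0 < m2 -> 0 < m4 ->
  (Q [set x | (\sum_(i <- s) l i * xi i x ^+ 2 <= m2 * (\sum_(i <- s) l i) / 2)%R]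
   <= (expR (- (m2 ^+ 2 * (\sum_(i <- s) l i) ^+ 2) /
        (16 * m4 * (\sum_(i <- s) l i ^+ 2))))%:E)%E.
Proof.
move=> us l0; set L2 := \sum_(i <- s) l i ^+ 2; set v := \sum_(i <- s) l i.
move=> L20 s20 m40; set t := m2 * v / (4 * L2 * m4).
have v0 : 0 <= v by apply: sumr_ge0.
have t0 : 0 <= t by rewrite /t divr_ge0 ?mulr_ge0// ltW// mulr_gt0// mulr_gt0.
have := @scenery_chernoff s (fun i r => expR (- (t * l i * r ^+ 2)))
  (fun=> 0) (fun i => - (t * l i)) (fun i => (t * l i) ^+ 2) 1
  (- (t * (m2 * v / 2))) _ us.
move=> /(_ [set x | (\sum_(i <- s) l i * xi i x ^+ 2 <= m2 * v / 2)%R]).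
have -> : - - (t * (m2 * v / 2)) + \sum_(i <- s) (- (t * l i) * m2 + (t * l i) ^+ 2 * m4)
  = - (m2 ^+ 2 * v ^+ 2) / (16 * m4 * L2).
  have -> : \sum_(i <- s) (- (t * l i) * m2 + (t * l i) ^+ 2 * m4) =
      - (t * m2) * v + t ^+ 2 * m4 * L2.
    rewrite /v /L2 !mulr_sumr -big_split/=; apply: eq_bigr => i _; ring.
  by rewrite opprK /t; field; rewrite !gt_eqF.
apply.
- move=> i; apply: measurableT_comp => //; apply: measurableT_comp => //.
  by apply: measurable_funM => //; exact: measurable_funX.
- by move=> i r; exact: expR_ge0.
- move=> i r; rewrite -[leRHS]expR0 ler_expR oppr_le0.
  by rewrite mulr_ge0 ?sqr_ge0// mulr_ge0.
- move=> i r; apply: le_trans (expRN_le _) _.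
    by rewrite mulr_ge0 ?sqr_ge0// mulr_ge0.
  by rewrite le_eqVlt; apply/orP; left; apply/eqP; ring.
- rewrite -[X in measurable X]setTI; apply: measurable_fun_le => //.
  apply: measurable_sum => i; apply: measurable_funM => //.
  exact: measurable_funX.
- move=> x /= h; rewrite -expR_sum ler_expR sumrN lerN2.
  under eq_bigr do rewrite -mulrA.
  by rewrite -mulr_sumr ler_wpM2l.
Qed.

(** A contribution [a r] is discarded as soon as it exceeds 1/2 in absolute
    value. *)
Definition trunc (a r : R) : R := if a * `|r| <= 1 / 2 then a * r else 0.

Lemma measurable_trunc a : measurable_fun setT (trunc a).
Proof.
apply: measurable_fun_if => //=.
- by apply: measurable_fun_ler => //; apply: measurable_funM => //;
    exact: normr_measurable.
Qed.

(** The truncated variable need not be centred, but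
    [exp (trunc a r) <= 1 + a r + 2 (a r)^2] holds for every [r], beyond the
    truncation because then [a r + 2 (a r)^2 >= 0]. So the bound is as for a
    centred variable, with no separate estimate of the truncated mean. *)
Lemma large_truncated_sum (s : seq I) (a : I -> R) (u : R) :
  uniq s -> (forall i, 0 <= a i) ->
  (Q [set x | (u <= \sum_(i <- s) trunc (a i) (xi i x))%R] <=
   (expR (- u + 2 * m2 * \sum_(i <- s) a i ^+ 2))%:E)%E.
Proof.
move=> us a0.
have tr2 i r : `|trunc (a i) r| <= 1 / 2.
  rewrite /trunc; case: ifP => [|_]; last by rewrite normr0.
  by rewrite normrM (ger0_norm (a0 i)).
have := @scenery_chernoff s (fun i r => expR (trunc (a i) r))
  a (fun i => 2 * a i ^+ 2) (fun i => 0) (expR (1 / 2)) u _ us.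
move=> /(_ [set x | (u <= \sum_(i <- s) trunc (a i) (xi i x))%R]).
have -> : - u + \sum_(i <- s) (2 * a i ^+ 2 * m2 + 0 * m4)
  = - u + 2 * m2 * \sum_(i <- s) a i ^+ 2.
  by rewrite mulr_sumr; congr (_ + _); apply: eq_bigr => i _; ring.
apply.
- by move=> i; apply: measurableT_comp => //; exact: measurable_trunc.
- by move=> i r; exact: expR_ge0.
- by move=> i r; rewrite ler_expR (le_trans (ler_norm _)).
- move=> i r; have := tr2 i r; rewrite /trunc; case: ifPn => [_ h|].
    apply: le_trans (expR_le_half (le_trans (ler_norm _) h)) _.
    by rewrite le_eqVlt; apply/orP; left; apply/eqP; ring.
  rewrite -ltNge expR0 => h _.
  suff : 0 <= a i * r * (1 + 2 * (a i * r)) by lra.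
  have [r0|r0] := lerP 0 r.
    by have := mulr_ge0 (a0 i) r0; nra.
  by move: h; rewrite ltr0_norm// mulrN => h; nra.
- rewrite -[X in measurable X]setTI; apply: measurable_fun_le => //.
  by apply: measurable_sum => i; apply: measurableT_comp => //; exact: measurable_trunc.
- by move=> x /= h; rewrite -expR_sum ler_expR.
Qed.

Lemma measurable_large_count (s : seq I) (a : I -> R) (N : nat) :
  measurable [set x | (N <= count (fun i => 1 / 2 < a i * `|xi i x|)%R s)%N].
Proof.
have mb i : measurable_fun setT (fun r : R => (1 / 2 < a i * `|r|)%R).
  by apply: measurable_fun_ltr => //; apply: measurable_funM => //;
    exact: normr_measurable.
pose c x := \sum_(i <- s) (if 1 / 2 < a i * `|xi i x| then 1 else 0) : R.
have -> : [set x | (N <= count (fun i => 1 / 2 < a i * `|xi i x|)%R s)%N] =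
    setT `&` [set x | N%:R <= c x].
  apply/seteqP; split => x /=; rewrite /c -big_mkcond/= big_const_seq iter_addr_0 ler_nat.
    by [].
  by case.
apply: measurable_fun_le => //; apply: measurable_sum => i.
have mg : measurable_fun setT (fun r : R => if 1 / 2 < a i * `|r| then 1 else 0 : R).
  by apply: measurable_fun_if.
by apply: (measurableT_comp mg).
Qed.

(** Chernoff's bound for the number of large values, each of which has
    probability at most [16 m4 a^4]. *)
Lemma many_large_values (s : seq I) (a : I -> R) (N : nat) (tau : R) :
  uniq s -> (forall i, 0 <= a i) -> 0 <= tau ->
  (Q [set x | (N <= count (fun i => 1 / 2 < a i * `|xi i x|)%R s)%N] <=
   (expR (- (tau * N%:R) + 16 * m4 * expR tau * \sum_(i <- s) a i ^+ 4))%:E)%E.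
Proof.
move=> us a0 tau0.
have mb i : measurable_fun setT (fun r : R => (1 / 2 < a i * `|r|)%R).
  by apply: measurable_fun_ltr => //; apply: measurable_funM => //;
    exact: normr_measurable.
pose f i (r : R) := expR (if 1 / 2 < a i * `|r| then tau else 0).
have := @scenery_chernoff s f
  (fun=> 0) (fun=> 0) (fun i => 16 * expR tau * a i ^+ 4) (expR tau) (tau * N%:R) _ us.
move=> /(_ [set x | (N <= count (fun i => 1 / 2 < a i * `|xi i x|)%R s)%N]).
have -> : - (tau * N%:R) + \sum_(i <- s) (0 * m2 + 16 * expR tau * a i ^+ 4 * m4)
  = - (tau * N%:R) + 16 * m4 * expR tau * \sum_(i <- s) a i ^+ 4.
  by rewrite mulr_sumr; congr (_ + _); apply: eq_bigr => i _; ring.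
have sumE x : \sum_(i <- s) (if 1 / 2 < a i * `|xi i x| then tau else 0) =
    tau * (count (fun i => 1 / 2 < a i * `|xi i x|)%R s)%:R.
  rewrite -big_mkcond/= big_const_seq iter_addr_0 mulr_natr.
  by [].
apply.
- by move=> i; apply: measurableT_comp => //; apply: measurable_fun_if.
- by move=> i r; exact: expR_ge0.
- by move=> i r; rewrite ler_expR; case: ifP.
- move=> i r; rewrite /f !mul0r !addr0; case: ifPn => [h|_]; last first.
    have p4 (x : R) : 0 <= x ^+ 4 by rewrite exprn_even_ge0.
    by rewrite expR0 lerDl mulr_ge0 ?p4// mulr_ge0 ?p4// mulr_ge0 ?expR_ge0.
  have : 1 <= 16 * (a i ^+ 4 * r ^+ 4).
    rewrite -exprMn -(_ : `|a i * r| ^+ 4 = (a i * r) ^+ 4); last first.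
      by rewrite -normrX ger0_norm// exprn_even_ge0.
    rewrite normrM (ger0_norm (a0 i)) (_ : 16 = 2 ^+ 4); last by ring.
    by rewrite -exprMn exprn_ege1//; move: h; lra.
  have := expR_gt0 tau; nra.
- exact: measurable_large_count.
- move=> x /= h; rewrite /f -expR_sum ler_expR sumE.
  by rewrite ler_wpM2l// ler_nat.
Qed.

End scenery.

(** * From walk events to words *)

Lemma measure_bigsetU_le d (T : measurableType d) (R : realType)
    (mu : {measure set T -> \bar R}) (I : Type) (s : seq I) (F : I -> set T) :
  (forall i, measurable (F i)) ->
  (mu (\big[setU/set0]_(i <- s) F i) <= \sum_(i <- s) mu (F i))%E.
Proof.
move=> mF; elim: s => [|i s IH]; first by rewrite !big_nil measure0.
rewrite !big_cons; apply: le_trans (leeD (lexx _) IH).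
by apply: measureU2 => //; exact: bigsetU_measurable.
Qed.

Fixpoint words (A : finType) n : seq (seq A) :=
  if n is m.+1 then [seq a :: u | a <- index_enum A, u <- words A m] else [:: [::]].

Lemma mem_words (A : finType) n (u : seq A) : (u \in words A n) = (size u == n).
Proof.
elim: n u => [|n IH] u /=; first by rewrite inE; case: u.
apply/allpairsP/idP => [[[a v] /= [_ vn ->]]|].
  by rewrite /= eqSS -IH.
case: u => [//|a u]; rewrite /= eqSS -IH => un.
by exists (a, u); split => //=; rewrite mem_index_enum.
Qed.

Lemma word_mean_words (R : realType) (A : finType) n (F : seq A -> R) :
  word_mean n F = #|A|%:R^-1 ^+ n * \sum_(u <- words A n) F u.
Proof.
elim: n F => [|n IH] F; first by rewrite /= big_seq1 expr0 mul1r.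
rewrite word_meanS [words _ _]/= big_allpairs_dep exprS -mulrA; congr (_ * _).
by rewrite mulr_sumr; apply: eq_bigr => a _; rewrite IH.
Qed.

Section walk_events.
Context {R : realType} {d : nat} {dW : measure_display} {W : measurableType dW}
  (P : probability W R) (S : nat -> {RV P >-> lattice d}).
Hypothesis d_gt0 : (0 < d)%N.
Hypothesis S_srw : simple_random_walk S.
Local Notation letter := ('I_d * bool)%type.

Lemma measurable_position k (B : set (lattice d)) : measurable (S k @^-1` B).
Proof. by rewrite -[_ @^-1` _]setTI; exact: measurable_funPT. Qed.

(** The difference of two lattice-valued variables is handled by splitting over
    the countably many values of the first. *)
Lemma measurable_increment k (B : set (lattice d)) :
  measurable (increment S k @^-1` B).
Proof.
have -> : increment S k @^-1` B = \bigcup_(z : lattice d)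
    (S k @^-1` [set z] `&` S k.+1 @^-1` [set v | B (v - z)]).
  apply/seteqP; split => w /=; first by move=> Bw; exists (S k w).
  by case=> z _ [/= <-].
apply: countable_bigcupT_measurable; first exact: countableP.
by move=> z; apply: measurableI; exact: measurable_position.
Qed.

Lemma unit_step_inj : injective (@unit_step d).
Proof.
move=> [i b] [j c] /rowP eq_ij; have /eqP := eq_ij i; have := eq_ij j.
rewrite !mxE !eqxx /=.
have [<-|ij] := eqVneq i j.
  by rewrite !mulr1 => + _; clear eq_ij; case: b; case: c.
by rewrite !mulr1 !mulr0 => _; rewrite signr_eq0.
Qed.

(** The [2d] unit vectors are distinct and each has probability [1 / 2d], so
    nothing is left for other increments. *)
Lemma increment_unit_step k :
  P [set w | exists a, increment S k w = unit_step a] = 1%E.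
Proof.
have [_ incr _] := S_srw.
have -> : [set w | exists a, increment S k w = unit_step a] =
    \bigcup_(a in [set: letter]) (increment S k @^-1` [set unit_step a]).
  by apply/seteqP; split => w /= [a]; [exists a|move=> _ ?; exists a].
rewrite measure_fin_bigcup; last 3 first.
- exact: finite_finset.
- by move=> a b _ _ [w [/= -> /unit_step_inj ->]].
- by move=> a _; exact: measurable_increment.
rewrite (@fsbigE _ _ _ _ _ (index_enum {: letter})); last 3 first.
- exact: index_enum_uniq.
- by [].
- by move=> a _; rewrite mem_index_enum.
rewrite (eq_bigr (fun=> ((2 * d)%:R^-1)%:E)) => [|[i b] _]; last exact: incr.
rewrite (eq_bigl xpredT) => [|a]; last by rewrite in_setT.
rewrite sumEFin sumr_const card_prod card_ord card_bool; congr EFin.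
rewrite -[_ *+ (d * 2)]mulr_natr mulnC mulVf// pnatr_eq0 muln_eq0 negb_or/= -lt0n.
by rewrite d_gt0.
Qed.

Definition follows n (u : seq letter) : set W :=
  \bigcap_(k in [set k | (k <= n)%N]) (S k @^-1` [set word_path u k]).

Lemma measurable_follows n u : measurable (follows n u).
Proof.
apply: bigcap_measurable; first by exists 0%N.
by move=> k _; exact: measurable_position.
Qed.

Lemma follows_le n u : size u = n ->
  (P (follows n u) <= (#|{: letter}|%:R^-1 ^+ n)%:E)%E.
Proof.
move=> un; have [_ incr indep] := S_srw.
have [a0 _|no_letter] := pickP (fun _ : letter => true); last first.
  have := no_letter (Ordinal d_gt0, true); by [].
pose B k := [set unit_step (nth a0 u k)] : set (lattice d).
pose J := [fset k in iota 0 n]%fset.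
have E := indep J B (fun k => I).
have JE : (\prod_(k <- J) P (increment S k @^-1` B k))%E =
    (#|{: letter}|%:R^-1 ^+ n)%:E.
  rewrite (perm_big (iota 0 n))/=; last first.
    by apply: uniq_perm; rewrite ?iota_uniq ?fset_uniq// => k; rewrite !inE.
  rewrite (eq_bigr (fun=> (#|{: letter}|%:R^-1)%:E)); last first.
    move=> k _; rewrite card_prod card_ord card_bool mulnC /B.
    by case: (nth a0 u k) => i b; exact: incr.
  by rewrite prodEFin big_const_seq count_predT size_iota iter_mulr_1.
rewrite -JE -E; apply: le_measure; rewrite ?inE.
- exact: measurable_follows.
- apply: fin_bigcap_measurable; first exact: finite_fset.
  by move=> k _; exact: measurable_increment.
move=> w fw k; rewrite /= !inE mem_iota add0n /= => kn.
rewrite /B /= /increment (fw k.+1)// (fw k)/=; last exact: ltnW.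
rewrite /word_path (take_nth a0) ?un// /endpoint -cats1 big_cat big_seq1/=.
by rewrite addrAC subrr add0r.
Qed.

Lemma almost_surely_follows n :
  exists N : set W, [/\ measurable N, P N = 0%E &
    forall w, ~ N w -> exists2 u, size u = n & follows n u w].
Proof.
have [S0 _ _] := S_srw.
pose A0 := [set w | S 0%N w = 0].
have mA0 : measurable A0 by exact: (measurable_position 0 [set 0]).
pose A k := [set w | exists a : letter, increment S k w = unit_step a].
have mA k : measurable (A k).
  exact: (measurable_increment k [set z | exists a : letter, z = unit_step a]).
exists (~` A0 `|` \big[setU/set0]_(k < n) ~` A k); split.
- apply: measurableU; first exact: measurableC.
  by apply: bigsetU_measurable => k _; exact: measurableC.
- have PC B : measurable B -> P B = 1%E -> P (~` B) = 0%E.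
    by move=> mB PB; rewrite probability_setC// PB subee.
  apply/eqP; rewrite eq_le measure_ge0 andbT.
  apply: le_trans (measureU2 _ _ _) _.
  + exact: measurableC.
  + by apply: bigsetU_measurable => k _; exact: measurableC.
  rewrite [X in (X + _)%E](_ : _ = 0%E); last exact: PC.
  rewrite add0e; apply: le_trans (measure_bigsetU_le _ _ _) _.
    by move=> k; exact: measurableC.
  rewrite big1// => k _; apply: PC => //; exact: increment_unit_step.
move=> w /not_orP[/contrapT w0 wn].
have {}wn k : (k < n)%N -> A k w.
  move=> kn; apply: contrapT => Akw; apply: wn.
  by rewrite -(bigcup_mkord n (fun k => ~` A k)); exists k.
have [v vE] : exists v : nat -> letter,
    forall k, (k < n)%N -> increment S k w = unit_step (v k).
  have a0 : letter := (Ordinal d_gt0, true).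
  have /choice[v vE] : forall k, exists a : letter,
      (k < n)%N -> increment S k w = unit_step a.
    move=> k; have [kn|kn] := ltnP k n; last by exists a0.
    by have [a ?] := wn k kn; exists a.
  by exists v.
exists (mkseq v n); first by rewrite size_mkseq.
move=> k /= kn; elim: k kn => [|k IH] kn.
  by rewrite /= w0 /word_path take0 /endpoint big_nil.
rewrite /= -[S k.+1 w](subrK (S k w)) -/(increment S k w) vE//.
rewrite (IH (ltnW kn)) /word_path (take_nth (v 0%N)) ?size_mkseq//.
by rewrite /endpoint -cats1 big_cat big_seq1/= nth_mkseq// addrC.
Qed.

Context {dX : measure_display} {X : measurableType dX} (Q : probability X R).
Variables (n : nat) (G : (nat -> lattice d) -> set X).
Hypothesis mG : forall p, measurable (G p).
Hypothesis G_local : forall p q, (forall k, (k <= n)%N -> p k = q k) -> G p = G q.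

Let event : set (X * W) := [set w | G (S ^~ w.2) w.1].

(** The event is a countable union of rectangles, over the lists of the first
    positions of the walk. *)
Lemma measurable_walk_event : measurable event.
Proof.
have -> : event = \bigcup_(s : seq (lattice d))
    (G (nth 0 s) `*` \bigcap_(k in [set k | (k <= n)%N]) (S k @^-1` [set nth 0 s k])).
  apply/seteqP; split => -[x w] /=.
    move=> Gxw; exists (mkseq (S ^~ w) n.+1) => //; split => /=.
      by rewrite (G_local (q := S ^~ w))// => k kn; rewrite nth_mkseq.
    by move=> k /= kn; rewrite nth_mkseq.
  case=> s _ [/= Gsx wS]; rewrite /event /=.
  by rewrite (@G_local _ (nth 0 s))// => k kn; exact: wS.
apply: countable_bigcupT_measurable; first exact: countableP.
move=> s; apply: measurableX => //.
apply: bigcap_measurable; first by exists 0%N.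
by move=> k _; exact: measurable_position.
Qed.

(** Averaging over the path first: up to a null set the event is the finite union,
    over the words [u], of the rectangles [G (word_path u) * follows n u]. *)
Lemma walk_event_le : ((Q \x P) event <=
  (word_mean n (fun u => fine (Q (G (word_path u)))))%:E)%E.
Proof.
have [N [mN PN0 HN]] := almost_surely_follows n.
pose F (u : seq letter) : set (X * W) := G (word_path u) `*` follows n u.
have mF u : measurable (F u) by apply: measurableX => //; exact: measurable_follows.
have mNN : measurable ([set: X] `*` N) by exact: measurableX.
apply: (@le_trans _ _ ((Q \x P) (([set: X] `*` N) `|`
    \big[setU/set0]_(u <- words letter n) F u))%E).
  apply: le_measure; rewrite ?inE.
  - exact: measurable_walk_event.
  - by apply: measurableU => //; exact: bigsetU_measurable.
  move=> [x w] /= Gxw; have [Nw|Nw] := pselect (N w); [by left|right].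
  have [u un uw] := HN w Nw.
  rewrite -bigcup_seq; exists u; first by rewrite /= mem_words un.
  split => //=; rewrite (G_local (q := S ^~ w))// => k kn.
  by rewrite -(uw k).
apply: le_trans (measureU2 _ _ _) _ => //.
  exact: bigsetU_measurable.
rewrite [X in (X + _)%E](_ : _ = 0%E); last first.
  by apply: etrans (product_measure1E Q P measurableT mN) _;
    rewrite [X in (_ * X)%E]PN0 mule0.
rewrite add0e; apply: le_trans (measure_bigsetU_le _ _ _) _ => //.
rewrite word_mean_words mulr_sumr -sumEFin big_seq [leRHS]big_seq.
apply: lee_sum => u; rewrite mem_words => /eqP un.
have mGu := mG (word_path u); have mfu := measurable_follows n u.
rewrite [X in (X <= _)%E](product_measure1E Q P mGu mfu).
rewrite EFinM muleC fineK ?fin_num_measure//.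
by rewrite lee_wpmul2r// follows_le.
Qed.

End walk_events.

(** * The functionals along a fixed path *)

Section path_functionals.
Context {R : realType} {d : nat}.
Variables (s : nat -> lattice d) (n : nat).
Implicit Types (x : lattice d -> R) (z : lattice d).

Definition path_range : seq (lattice d) := undup [seq s k | k <- iota 0 n.+1].

Local Notation loc z := ((local_time s n z)%:R : R).

Lemma path_range_uniq : uniq path_range. Proof. exact: undup_uniq. Qed.

Lemma mem_path_range (k : 'I_n.+1) : s k \in path_range.
Proof. by rewrite mem_undup; apply: map_f; rewrite mem_iota/= add0n. Qed.

Lemma local_time_out z : z \notin path_range -> local_time s n z = 0%N.
Proof.
move=> zr; rewrite /local_time big1// => k _; case: eqP => // skz.
by move: zr; rewrite -skz mem_path_range.
Qed.

Lemma scenery_sumE x : scenery_sum x s n = \sum_(z <- path_range) loc z * x z.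
Proof.
rewrite /scenery_sum.
under [RHS]eq_bigr => z _ do rewrite natr_sum mulr_suml.
rewrite exchange_big/=; apply: eq_bigr => k _.
rewrite (bigD1_seq (s k)) ?mem_path_range ?path_range_uniq//= eqxx mul1r.
by rewrite big1 ?addr0// => z; rewrite eq_sym => /negbTE ->; rewrite mul0r.
Qed.

Lemma local_time_sum : \sum_(z <- path_range) loc z = n.+1%:R.
Proof.
have := scenery_sumE (fun=> 1); rewrite /scenery_sum sumr_const card_ord => ->.
by apply: eq_bigr => z _; rewrite mulr1.
Qed.

(** [f] takes the local time as an argument so that its vanishing at 0 makes the
    sum over the lattice a sum over the range of the path. *)
Lemma lattice_sumE (f : nat -> lattice d -> R) : (forall z, f 0%N z = 0) ->
  \sum_(z \in [set: lattice d]) f (local_time s n z) z =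
  \sum_(z <- path_range) f (local_time s n z) z.
Proof.
move=> f0; rewrite (@fsbigE _ _ _ _ _ path_range).
- by apply: eq_bigl => z; rewrite in_setT.
- exact: path_range_uniq.
- by [].
- by move=> z _ /local_time_out ->.
Qed.

Lemma scenery_varE x :
  scenery_var x s n = Num.sqrt (\sum_(z <- path_range) loc z * x z ^+ 2).
Proof.
rewrite /scenery_var (lattice_sumE (f := fun m z => m%:R * x z ^+ 2))// => z.
by rewrite mul0r.
Qed.

Lemma local_time_norm2E :
  local_time_norm2 s n = Num.sqrt (\sum_(z <- path_range) loc z ^+ 2) :> R.
Proof.
rewrite /local_time_norm2 (lattice_sumE (f := fun m z => m%:R ^+ 2))// => z.
by rewrite expr0n.
Qed.

(** [l <= l^2] for integers. *)
Lemma local_time_sqr_ge : n.+1%:R <= \sum_(z <- path_range) loc z ^+ 2.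
Proof.
rewrite -local_time_sum; apply: ler_sum => z _.
case: (local_time s n z) => [|m]; first by rewrite expr0n.
by rewrite expr2 ler_peMl// ler1n.
Qed.

Variables (N : nat) (y : R).
Hypothesis n_gt0 : (0 < n)%N.
Hypothesis N_gt0 : (0 < N)%N.
Hypothesis y_gt0 : 0 < y.
Hypothesis spread_path : forall B : seq (lattice d), uniq B -> (size B <= N)%N ->
  (\sum_(z <- B) local_time s n z)%N%:R <= y ^+ 2 / 8.

Local Notation L2 := (\sum_(z <- path_range) loc z ^+ 2).
Local Notation low := [seq z <- path_range | loc z <= y ^+ 2 / (8 * N%:R)].

Lemma local_time_le z : loc z <= y ^+ 2 / 8.
Proof. by have := @spread_path [:: z] isT N_gt0; rewrite big_seq1. Qed.

Lemma norm2_le : L2 <= y ^+ 2 / 8 * n.+1%:R.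
Proof.
rewrite -local_time_sum mulr_sumr; apply: ler_sum => z _.
by rewrite expr2 ler_wpM2r// local_time_le.
Qed.

(** Otherwise [N] of these sites would carry more than [N y^2 / (8 N)]. *)
Lemma size_high :
  (size [seq z <- path_range | (y ^+ 2 / (8 * N%:R) < loc z)%R] < N)%N.
Proof.
rewrite ltnNge; apply/negP => NH.
set H := seq.filter _ _ in NH.
have sB : size (take N H) = N by rewrite size_takel.
have uB : uniq (take N H) by rewrite take_uniq// filter_uniq// path_range_uniq.
have := spread_path uB; rewrite sB => /(_ (leqnn _)); apply/negP; rewrite -ltNge.
have -> : y ^+ 2 / 8 = \sum_(z <- take N H) y ^+ 2 / (8 * N%:R).
  rewrite big_const_seq count_predT sB iter_addr_0 -[_ *+ _]mulr_natr.
  by field; rewrite pnatr_eq0 -lt0n N_gt0.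
rewrite natr_sum big_seq [ltRHS]big_seq; apply: ltr_sum.
  apply/hasP; exists (nth 0 (take N H) 0); first by rewrite mem_nth// sB.
  by rewrite mem_nth// sB.
by move=> z /mem_take; rewrite mem_filter => /andP[].
Qed.

(** Both the sites of [p] of low local time and the sites of high local time are
    fewer than [N], and each family carries at most [y^2 / 8]. *)
Lemma sum_local_time_le (p : pred (lattice d)) :
  (count p low < N)%N -> \sum_(z <- path_range | p z) loc z <= y ^+ 2 / 4.
Proof.
move=> pN; rewrite (bigID (fun z => loc z <= y ^+ 2 / (8 * N%:R)))/=.
have -> : y ^+ 2 / 4 = y ^+ 2 / 8 + y ^+ 2 / 8 by field.
apply: lerD.
  have -> : \sum_(z <- path_range | p z && (loc z <= y ^+ 2 / (8 * N%:R))) loc z =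
      (\sum_(z <- [seq z <- low | p z]) local_time s n z)%N%:R.
    by rewrite natr_sum big_filter big_filter_cond; apply: eq_bigl => z; rewrite andbC.
  apply: spread_path; first by rewrite !filter_uniq// path_range_uniq.
  by rewrite size_filter ltnW.
apply: (@le_trans _ _ (\sum_(z <- [seq z <- path_range |
    (y ^+ 2 / (8 * N%:R) < loc z)%R]) local_time s n z)%N%:R).
  rewrite natr_sum big_filter big_mkcond [leRHS]big_mkcond/=; apply: ler_sum => z _.
  by rewrite ltNge; case: (p z) => //=; case: ifP => //; rewrite ler0n.
by apply: spread_path (ltnW size_high); rewrite filter_uniq// path_range_uniq.
Qed.

Variables (m2 : R) (x : lattice d -> R).
Hypothesis m2_gt0 : 0 < m2.

Local Notation lam := (Num.sqrt (m2 / 8) / (4 * m2) * y / Num.sqrt L2).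

(** Let [p] single out the bad sites. If neither the first nor the third
    alternative holds, then the bad sites contribute at most [y V / 2], which
    leaves [y V L / (2 sqrt n) >= b y L] for the good ones, as [V >= 2 b sqrt n]
    with [b = sqrt (m2 / 8)]. The factor [b / (4 m2)] of [lam] is the one that
    optimizes the bound of [large_truncated_sum] for the level [lam b y L], which
    is [y^2 / 32]. *)
Lemma self_normalized_cases : y <= self_normalized x s n ->
  [\/ \sum_(z <- path_range) loc z * x z ^+ 2 <=
        m2 * (\sum_(z <- path_range) loc z) / 2,
      y ^+ 2 / 32 <= \sum_(z <- path_range) trunc (lam * loc z) (x z) |
      (N <= count (fun z => 1 / 2 < lam * loc z * `|x z|)%R low)%N].
Proof.
pose p z : bool := 1 / 2 < lam * loc z * `|x z|.
set b := Num.sqrt (m2 / 8) in p *; set L := Num.sqrt L2 in p *.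
rewrite /self_normalized scenery_sumE scenery_varE local_time_norm2E -/L => yT.
set v2 := \sum_(z <- path_range) loc z * x z ^+ 2.
rewrite local_time_sum.
have [|v2m] := lerP v2 (m2 * n.+1%:R / 2); first by constructor 1.
have [|cN] := leqP N (count p low); first by constructor 3.
constructor 2.
set V := Num.sqrt v2 in yT.
have n1 : 1 <= n%:R :> R by rewrite ler1n.
have L2n : n%:R <= L2 by apply: le_trans local_time_sqr_ge; rewrite ler_nat.
have L20 : 0 < L2 by apply: lt_le_trans L2n; rewrite ltr0n.
have L0 : 0 < L by rewrite sqrtr_gt0.
have nL : Num.sqrt n%:R <= L by rewrite ler_wsqrtr.
have sn0 : 0 < Num.sqrt n%:R :> R by rewrite sqrtr_gt0 ltr0n.
have v20 : 0 < v2 by apply: le_lt_trans v2m; rewrite divr_ge0// mulr_ge0// ltW.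
have V0 : 0 < V by rewrite sqrtr_gt0.
have VV : V ^+ 2 = v2 by rewrite sqr_sqrtr// ltW.
have b0 : 0 < b by rewrite sqrtr_gt0 divr_gt0.
have bb : b ^+ 2 = m2 / 8 by rewrite sqr_sqrtr// divr_ge0// ltW.
have lam0 : 0 < b / (4 * m2) * y / L by rewrite divr_gt0// mulr_gt0// divr_gt0// mulr_gt0.
have bV : 2 * b * Num.sqrt n%:R <= V.
  rewrite -(@ler_pXn2r _ 2)// ?nnegrE ?mulr_ge0 ?(ltW b0) ?(ltW V0) ?sqrtr_ge0//.
  rewrite VV !exprMn bb sqr_sqrtr ?ler0n//.
  apply: le_trans (ltW v2m); rewrite -[n.+1%:R]natr1.
  have : 0 <= m2 by exact: ltW.
  lra.
move: yT; rewrite ler_pdivlMr ?mulr_gt0//.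
rewrite (bigID p)/= => yT.
have TA : \sum_(z <- path_range | p z) loc z * x z <= y * V / 2.
  (* Cauchy-Schwarz as [x <= V / y + y x^2 / (4 V)] under the weights [loc]. *)
  apply: (@le_trans _ _ (V / y * (\sum_(z <- path_range | p z) loc z) +
      y / (4 * V) * v2)).
    rewrite /v2 [\sum_(z <- path_range) _ * _](bigID p)/= mulrDr addrA.
    apply: (@le_trans _ _ (V / y * (\sum_(z <- path_range | p z) loc z) +
      y / (4 * V) * (\sum_(z <- path_range | p z) loc z * x z ^+ 2))).
      rewrite !mulr_sumr -big_split/=; apply: ler_sum => z _.
      rewrite -subr_ge0 (_ : _ - _ = loc z * (V / y) * (1 - y / (2 * V) * x z) ^+ 2).
        by rewrite mulr_ge0 ?sqr_ge0// mulr_ge0 ?divr_ge0// ltW.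
      by field; rewrite !gt_eqF.
    rewrite lerDl mulr_ge0//; first by rewrite divr_ge0 ?mulr_ge0// ltW.
    by apply: sumr_ge0 => z _; rewrite mulr_ge0 ?sqr_ge0.
  have -> : y * V / 2 = V / y * (y ^+ 2 / 4) + y / (4 * V) * v2.
    by rewrite -VV; field; rewrite !gt_eqF.
  rewrite lerD2r ler_wpM2l ?divr_ge0 ?(ltW V0) ?(ltW y_gt0)//.
  exact: sum_local_time_le cN.
set TG := \sum_(z <- path_range | ~~ p z) _ in yT.
have -> : \sum_(z <- path_range) trunc (b / (4 * m2) * y / L * loc z) (x z) =
    b / (4 * m2) * y / L * TG.
  rewrite /TG mulr_sumr [RHS]big_mkcond/=; apply: eq_bigr => z _.
  by rewrite /trunc /p -leNgt; case: ifP => // _; rewrite mulrA.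
have TG1 : y * V * L / 2 <= TG * Num.sqrt n%:R.
  have : (\sum_(z <- path_range | p z) loc z * x z) * Num.sqrt n%:R <= y * V / 2 * L.
    apply: le_trans (ler_wpM2r (ltW sn0) TA) _.
    by rewrite ler_wpM2l// divr_ge0// mulr_ge0// ltW.
  move: yT; rewrite mulrDl; lra.
have TG2 : y * L * b <= TG.
  rewrite -(ler_pM2r sn0); apply: le_trans TG1.
  rewrite (_ : y * L * b * _ = y * L / 2 * (2 * b * Num.sqrt n%:R)); last by field.
  rewrite (_ : y * V * L / 2 = y * L / 2 * V); last by field.
  by rewrite ler_wpM2l// divr_ge0// mulr_ge0// ltW.
apply: le_trans (ler_wpM2l (ltW lam0) TG2).
rewrite le_eqVlt; apply/orP; left; apply/eqP.
transitivity (b ^+ 2 / (4 * m2) * y ^+ 2); last by field; rewrite !gt_eqF.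
by rewrite bb; field; rewrite gt_eqF.
Qed.

End path_functionals.

(** * Conditional probability given the path *)

Lemma self_normalized_local (R : realType) (d : nat) (x : lattice d -> R)
    (p q : nat -> lattice d) n :
  (forall k, (k <= n)%N -> p k = q k) ->
  self_normalized x p n = self_normalized x q n.
Proof.
move=> pq; have loc : local_time p n = local_time q n.
  apply/funext => z; apply: eq_bigr => k _.
  by rewrite pq// -ltnS.
rewrite /self_normalized /scenery_var /local_time_norm2 loc.
congr (_ * _ / _); apply: eq_bigr => k _.
by rewrite pq// -ltnS.
Qed.

(** A form without square roots and quotients, from which the event is seen to be
    measurable. *)
Lemma le_self_normalized (R : realType) (d : nat) (x : lattice d -> R)
    (s : nat -> lattice d) n (y : R) : 0 < y ->
  (y <= self_normalized x s n) =
  [&& 0 < \sum_(z <- path_range s n) (local_time s n z)%:R * x z ^+ 2,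
      0 <= scenery_sum x s n &
      y ^+ 2 * (\sum_(z <- path_range s n) (local_time s n z)%:R ^+ 2) *
        (\sum_(z <- path_range s n) (local_time s n z)%:R * x z ^+ 2) <=
      scenery_sum x s n ^+ 2 * n%:R].
Proof.
move=> y0; rewrite /self_normalized scenery_varE local_time_norm2E.
set v2 := \sum_(z <- _) _ * x _ ^+ 2; set l2 := \sum_(z <- _) _.
set T := scenery_sum x s n.
have l20 : 0 < l2 by apply: lt_le_trans (local_time_sqr_ge s n); rewrite ltr0n.
have v20 : 0 <= v2 by apply: sumr_ge0 => z _; rewrite mulr_ge0 ?sqr_ge0.
have [v2_gt0|] /= := ltP 0 v2; last first.
  move=> v2_le0; rewrite (_ : v2 = 0); last by apply/eqP; rewrite eq_le v2_le0.
  by rewrite sqrtr0 mul0r invr0 mulr0 leNgt y0.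
rewrite ler_pdivlMr ?mulr_gt0 ?sqrtr_gt0//.
have a0 : 0 < y * (Num.sqrt v2 * Num.sqrt l2) by rewrite !mulr_gt0 ?sqrtr_gt0.
have -> : y ^+ 2 * l2 * v2 = (y * (Num.sqrt v2 * Num.sqrt l2)) ^+ 2.
  by rewrite !exprMn !sqr_sqrtr// ?(ltW l20)//; ring.
have -> : T ^+ 2 * n%:R = (T * Num.sqrt n%:R) ^+ 2.
  by rewrite exprMn sqr_sqrtr.
have [T0|T0] /= := lerP 0 T.
  rewrite ler_pXn2r// nnegrE; first exact: ltW.
  by rewrite mulr_ge0 ?sqrtr_ge0.
apply/negbTE; rewrite -ltNge; apply: le_lt_trans a0.
by rewrite mulr_le0_ge0 ?sqrtr_ge0// ltW.
Qed.

Section conditional.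
Context {R : realType} {d0 : measure_display} {T0 : measurableType d0}
  {P0 : probability T0 R} (xi0 : {RV P0 >-> R}).
Hypothesis xi0_mean : ('E_P0[xi0] = 0)%E.
Hypothesis xi0_moment4 : ('E_P0[fun t => (xi0 t ^+ 4)%R] < +oo)%E.
Context {d : nat} {dX : measure_display} {X : measurableType dX}
  {Q : probability X R} (xi : lattice d -> {RV Q >-> R}).
Hypothesis xi_iid : iid_copies xi xi0.
Local Notation m2 := (moment xi0 2).
Local Notation m4 := (moment xi0 4).
Hypothesis m2_gt0 : 0 < m2.

(** If the fourth moment vanished, then integrating
    [0 <= (1 - c r^2 / 2)^2] with [c = 2 / m2] would give [0 <= 1 - c m2 = -1]. *)
Lemma moment4_gt0 : 0 < m4.
Proof.
rewrite lt_neqAle moment4_ge0 andbT eq_sym; apply/negP => /eqP m40.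
have := @mean_poly_le R d0 T0 P0 xi0 xi0_mean xi0_moment4
  (fun=> 0) 0 (- (2 / m2)) ((2 / m2) ^+ 2).
rewrite m40 mulr0 addr0 mulNr divfK ?gt_eqF// integral0 => h.
have : (0 <= (1 + - 2)%:E :> \bar R)%E.
  apply: h => // r; set c := 2 / m2.
  have -> : 1 + 0 * r + - c * r ^+ 2 + c ^+ 2 * r ^+ 4 =
      (1 - c * r ^+ 2 / 2) ^+ 2 + 3 / 4 * (c * r ^+ 2) ^+ 2 by field.
  by rewrite addr_ge0 ?sqr_ge0// mulr_ge0 ?sqr_ge0.
by clear h; rewrite lee_fin; lra.
Qed.

Variable n : nat.
Hypothesis n_gt0 : (0 < n)%N.

Lemma measurable_event s y : 0 < y ->
  measurable [set x | (y <= self_normalized (xi ^~ x) s n)%R].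
Proof.
move=> y0.
have mT : measurable_fun setT (fun x => scenery_sum (xi ^~ x) s n).
  by apply: measurable_sum => k.
have mV : measurable_fun setT (fun x =>
    \sum_(z <- path_range s n) (local_time s n z)%:R * (xi z x) ^+ 2).
  apply: measurable_sum => z; apply: measurable_funM => //; exact: measurable_funX.
have -> : [set x | (y <= self_normalized (xi ^~ x) s n)%R] =
    (setT `&` [set x | (0 < \sum_(z <- path_range s n) (local_time s n z)%:R * (xi z x) ^+ 2)%R]) `&`
    ((setT `&` [set x | (0 <= scenery_sum (xi ^~ x) s n)%R]) `&`
     (setT `&` [set x | (y ^+ 2 * (\sum_(z <- path_range s n) (local_time s n z)%:R ^+ 2) *
        (\sum_(z <- path_range s n) (local_time s n z)%:R * (xi z x) ^+ 2) <=
        scenery_sum (xi ^~ x) s n ^+ 2 * n%:R)%R])).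
  rewrite !setTI; apply/seteqP; split => x /=; rewrite le_self_normalized//.
    by move=> /and3P[].
  by move=> [? [? ?]]; apply/and3P.
apply: measurableI.
  have -> : forall f : X -> R, setT `&` [set x | (0 < f x)%R] =
      ~` (setT `&` [set x | (f x <= 0)%R]).
    move=> f; rewrite !setTI; apply/seteqP; split => x /=.
      by move=> fx; apply/negP; rewrite -ltNge.
    by move/negP; rewrite -ltNge.
  by apply: measurableC; exact: measurable_fun_le.
apply: measurableI; apply: measurable_fun_le => //.
  exact: measurable_funM.
by apply: measurable_funM => //; exact: measurable_funX.
Qed.

Variables (s : nat -> lattice d) (N : nat) (y tau : R).
Hypothesis N_gt0 : (0 < N)%N.
Hypothesis y_gt0 : 0 < y.
Hypothesis tau_ge0 : 0 <= tau.
Hypothesis spread_path : forall B : seq (lattice d), uniq B -> (size B <= N)%N ->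
  (\sum_(z <- B) local_time s n z)%N%:R <= y ^+ 2 / 8.

Local Notation kap := (m4 / m2 ^+ 2).
Local Notation loc z := ((local_time s n z)%:R : R).
Local Notation L2 := (\sum_(z <- path_range s n) loc z ^+ 2).
Local Notation lam := (Num.sqrt (m2 / 8) / (4 * m2) * y / Num.sqrt L2).

Lemma low_fourth_moment :
  \sum_(z <- path_range s n | loc z <= y ^+ 2 / (8 * N%:R)) loc z ^+ 4 <=
  (y ^+ 2 / (8 * N%:R)) ^+ 3 * n.+1%:R.
Proof.
set m := y ^+ 2 / _; have m0 : 0 <= m by rewrite divr_ge0 ?sqr_ge0 ?mulr_ge0.
rewrite -(local_time_sum (R := R) s n) mulr_sumr big_mkcond/=; apply: ler_sum => z _.
case: ifPn => [h|_]; last by rewrite mulr_ge0 ?exprn_ge0.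
by rewrite exprSr ler_wpM2r// lerXn2r ?nnegrE.
Qed.

Lemma lam_sqr : lam ^+ 2 * L2 = y ^+ 2 / (128 * m2).
Proof.
have L20 : 0 < L2 by apply: lt_le_trans (local_time_sqr_ge s n); rewrite ltr0n.
rewrite !(exprMn, exprVn) !sqr_sqrtr ?(ltW L20)//; last first.
  by rewrite divr_ge0// ltW.
by field; rewrite !gt_eqF.
Qed.

(** One term for each alternative of [self_normalized_cases]; the local time
    enters only through [L^2 <= (n + 1) y^2 / 8] in the first and through the
    fourth powers of the low local times in the third. *)
Lemma conditional_le :
  (Q [set x | (y <= self_normalized (xi ^~ x) s n)%R] <=
   (expR (- (n.+1%:R / (2 * kap * y ^+ 2))) + expR (- (y ^+ 2 / 64)) +
    expR (- (tau * N%:R) + kap * expR tau * y ^+ 10 / (N%:R ^+ 3 * n.+1%:R)))%:E)%E.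
Proof.
have m40 := moment4_gt0.
have n0 : 0 < n.+1%:R :> R by rewrite ltr0n.
have L2n : n.+1%:R <= L2 := local_time_sqr_ge s n.
have L20 : 0 < L2 by apply: lt_le_trans L2n.
have ur := path_range_uniq s n.
have lam0 : 0 <= lam.
  by rewrite divr_ge0 ?sqrtr_ge0// mulr_ge0 ?(ltW y_gt0)// divr_ge0 ?sqrtr_ge0// mulr_ge0// ltW.
have l0 z : 0 <= loc z by [].
have a0 z : 0 <= lam * loc z by rewrite mulr_ge0.
set low := [seq z <- path_range s n | loc z <= y ^+ 2 / (8 * N%:R)].
have ulow : uniq low by rewrite filter_uniq.
have S1 := small_scenery_var xi0_mean xi0_moment4 xi_iid ur l0 L20 m2_gt0 m40.
have S2 := large_truncated_sum xi0_mean xi0_moment4 xi_iid (y ^+ 2 / 32) ur a0.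
have S3 := many_large_values xi0_mean xi0_moment4 xi_iid N ulow a0 tau_ge0.
set A1 := [set x | _] in S1; set A2 := [set x | _] in S2; set A3 := [set x | _] in S3.
have mA1 : measurable A1.
  rewrite -[A1]setTI; apply: measurable_fun_le => //.
  apply: measurable_sum => z; apply: measurable_funM => //; exact: measurable_funX.
have mA2 : measurable A2.
  rewrite -[A2]setTI; apply: measurable_fun_le => //.
  by apply: measurable_sum => z; apply: measurableT_comp => //; exact: measurable_trunc.
have mA3 : measurable A3 by exact: measurable_large_count.
apply: (@le_trans _ _ (Q (A1 `|` A2 `|` A3))).
  apply: le_measure; rewrite ?inE.
  - exact: measurable_event.
  - by apply: measurableU => //; exact: measurableU.
  move=> x /= /(self_normalized_cases n_gt0 N_gt0 y_gt0 spread_path m2_gt0) [h|h|h].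
  - by left; left.
  - by left; right.
  - by right.
apply: le_trans (measureU2 _ _ _) _ => //; first exact: measurableU.
rewrite EFinD; apply: leeD.
  apply: le_trans (measureU2 _ _ _) _ => //.
  rewrite EFinD; apply: leeD.
    apply: le_trans S1 _; rewrite lee_fin ler_expR local_time_sum mulNr lerN2.
    have L2le := norm2_le N_gt0 spread_path.
    rewrite ler_pdivlMr ?mulr_gt0//.
    rewrite (_ : n.+1%:R / _ * _ = (m2 ^+ 2 * n.+1%:R) * (8 * L2 / y ^+ 2)); last first.
      by field; rewrite !gt_eqF.
    have -> : m2 ^+ 2 * n.+1%:R ^+ 2 = (m2 ^+ 2 * n.+1%:R) * n.+1%:R by ring.
    apply: ler_wpM2l; first by rewrite mulr_ge0 ?sqr_ge0.
    by rewrite ler_pdivrMr ?exprn_gt0//; move: L2le; lra.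
  apply: le_trans S2 _; rewrite lee_fin ler_expR.
  under eq_bigr do rewrite exprMn.
  rewrite -mulr_sumr lam_sqr le_eqVlt; apply/orP; left; apply/eqP.
  by field; rewrite gt_eqF.
apply: le_trans S3 _; rewrite lee_fin ler_expR lerD2l.
under eq_bigr do rewrite exprMn.
rewrite -mulr_sumr big_filter.
have e0 := expR_gt0 tau.
have yN0 : 0 <= (y ^+ 2 / (8 * N%:R)) ^+ 3.
  by rewrite exprn_ge0// divr_ge0 ?sqr_ge0 ?mulr_ge0.
have lam4 : lam ^+ 4 * n.+1%:R <= (y ^+ 2 / (128 * m2)) ^+ 2 / n.+1%:R.
  have aux (l A B : R) : 0 <= A -> A <= B -> l ^+ 4 * A * A <= (l ^+ 2 * B) ^+ 2.
    move=> A0 AB; have -> : (l ^+ 2 * B) ^+ 2 = l ^+ 4 * (B * B) by ring.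
    by rewrite -mulrA ler_wpM2l ?exprn_even_ge0// ler_pM.
  by rewrite ler_pdivlMr// -lam_sqr aux.
apply: (@le_trans _ _ (16 * m4 * expR tau *
    ((y ^+ 2 / (8 * N%:R)) ^+ 3 * ((y ^+ 2 / (128 * m2)) ^+ 2 / n.+1%:R)))).
  rewrite ler_wpM2l ?mulr_ge0 ?(ltW e0) ?(ltW m40)//.
  apply: le_trans (ler_wpM2l (exprn_ge0 4 lam0) low_fourth_moment) _.
  by rewrite mulrCA ler_wpM2l.
have N0 : 0 < N%:R :> R by rewrite ltr0n.
rewrite (_ : 16 * m4 * _ * _ =
    (kap * expR tau * y ^+ 10 / (N%:R ^+ 3 * n.+1%:R)) *
    (32^-1 * (128^-1 * 128^-1))); last first.
  by field; rewrite !gt_eqF.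
have kapN0 : 0 <= kap * expR tau * y ^+ 10 / (N%:R ^+ 3 * n.+1%:R).
  by rewrite divr_ge0 ?mulr_ge0 ?invr_ge0 ?exprn_ge0// ltW.
rewrite ler_piMr//.
have c32 : (32^-1 : R) <= 1 by lra.
have c128 : (128^-1 : R) <= 1 by lra.
by rewrite mulr_ile1 ?mulr_ge0 ?invr_ge0// mulr_ile1 ?invr_ge0.
Qed.

End conditional.

(** * Choice of the parameters *)

Section joint.
Context {R : realType} {d : nat} (d_ge3 : (3 <= d)%N)
  {dW : measure_display} {W : measurableType dW} {P : probability W R}
  (S : nat -> {RV P >-> lattice d}) (S_srw : simple_random_walk S)
  {d0 : measure_display} {T0 : measurableType d0} {P0 : probability T0 R}
  (xi0 : {RV P0 >-> R})
  (xi0_mean : ('E_P0[xi0] = 0)%E)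
  (xi0_moment4 : ('E_P0[fun t => (xi0 t ^+ 4)%R] < +oo)%E)
  {dX : measure_display} {X : measurableType dX} {Q : probability X R}
  (xi : lattice d -> {RV Q >-> R}) (xi_iid : iid_copies xi xi0)
  (m2_gt0 : 0 < moment xi0 2).

Lemma joint_le n N (y tau : R) :
  (0 < n)%N -> (0 < N)%N -> 0 < y -> 0 <= tau ->
  ((Q \x P) [set w | (y <= self_normalized (xi ^~ w.1) (S ^~ w.2) n)%R] <=
   (2 * n.*2.+1%:R ^+ (d * N) *
      expR (- (y ^+ 2 / 8) / (16 * d%:R * N%:R `^ (2 / d%:R))) +
    (expR (- (n.+1%:R / (2 * (moment xi0 4 / moment xi0 2 ^+ 2) * y ^+ 2))) +
     expR (- (y ^+ 2 / 64)) +
     expR (- (tau * N%:R) + moment xi0 4 / moment xi0 2 ^+ 2 * expR tau *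
       y ^+ 10 / (N%:R ^+ 3 * n.+1%:R))))%:E)%E.
Proof.
move=> n0 N0 y0 tau0; have d_gt0 : (0 < d)%N by apply: leq_trans d_ge3.
have c0 : (0 < #|{: 'I_d * bool}|)%N.
  by rewrite card_prod card_ord card_bool muln_gt0 d_gt0.
pose G (p : nat -> lattice d) : set X := [set x | (y <= self_normalized (xi ^~ x) p n)%R].
have mG p : measurable (G p) by exact: measurable_event.
have Gl p q : (forall k, (k <= n)%N -> p k = q k) -> G p = G q.
  by move=> pq; apply/seteqP; split => x; rewrite /G /= (self_normalized_local _ pq).
apply: le_trans (walk_event_le d_gt0 S_srw Q mG Gl) _.
rewrite lee_fin; set C := (X in _ + X).
apply: le_trans (lerD (mean_not_spread n (y ^+ 2 / 8) d_ge3 N0) (lexx C)).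
rewrite -[X in _ <= _ + X](word_mean_cst (A := ('I_d * bool)%type) n C c0) -word_meanD.
apply: word_mean_le => u un.
have C0 : 0 <= C by rewrite !addr_ge0 ?expR_ge0.
have Q1 : (Q (G (word_path u)) <= 1)%E by exact: probability_le1.
have Qf : Q (G (word_path u)) \is a fin_num by rewrite fin_num_measure.
have [spr|_] := boolP (spread n N (y ^+ 2 / 8) u).
  rewrite add0r -lee_fin fineK//; apply: conditional_le => // B uB BN.
  exact: spread_local_time spr uB BN.
by rewrite -[leLHS]addr0 lerD//= -lee_fin fineK.
Qed.

End joint.

Section rate.
Context {R : realType}.
Implicit Types (d n N : nat) (y tau kap : R).

Lemma ln_le_div100 (t : R) : 0 < t -> ln t <= t / 100 + ln 100.
Proof.
move=> t0; have tE : t = t / 100 * 100 by field.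
rewrite {1}tE lnM ?posrE ?divr_gt0//.
by rewrite lerD2r; apply/ltW/ln_sublinear; rewrite divr_gt0.
Qed.

Lemma budget_large_values (a dk L N Y : R) :
  Y <= N -> a <= dk / 60 -> dk <= N * L -> N <= L / 60 * N ->
  - (L / 30 * N) + Y <= - a.
Proof. lra. Qed.

Lemma budget_logs (lk ld l100 L ll ly lr : R) :
  20 * (lk - 4 * ld + 12 / 5 * l100) <= L -> 0 <= L ->
  3 / 5 * (2 * ly - ll) <= lr -> 6 * ly <= L -> ll <= L / 100 + l100 ->
  lk + L / 30 + 10 * ly <= 4 * (ld + lr) + L.
Proof. lra. Qed.

(** [N] is close to [del rho] and [tau = ln n / 30]. With [eta^2] of order
    [1 / d^2] and [del = eta^d / 2], the exponent [y^2 / (128 d N^(2/d))] of the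
    walk estimate is at least [K / (128 d eta^2) = (2 d + 2) K], which exceeds the
    entropy [2 d K] of the choice of [N] sites. In the last term [N^4] is at least [(del rho)^4], and
    [rho >= (y^2 / ln n)^(3/5)], so that it remains to compare
    [y^(26/5) <= n^(26/30)] with [n^(29/30)]; the powers of [ln n] and the
    constants are absorbed since [ln n] is large. *)
Lemma rate_bound d kap : (3 <= d)%N -> 0 < kap -> exists c Lam : R,
  0 < c /\ forall n y, Lam <= ln n%:R -> Lam * ln n%:R <= y ^+ 2 -> 0 < y ->
  y ^+ 6 <= n%:R ->
  exists N tau, [/\ (0 < n)%N, (0 < N)%N, 0 <= tau &
   2 * n.*2.+1%:R ^+ (d * N) *
      expR (- (y ^+ 2 / 8) / (16 * d%:R * N%:R `^ (2 / d%:R))) +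
    (expR (- (n.+1%:R / (2 * kap * y ^+ 2))) +
     expR (- (y ^+ 2 / 64)) +
     expR (- (tau * N%:R) + kap * expR tau * y ^+ 10 / (N%:R ^+ 3 * n.+1%:R)))
   <= expR (- (c * (y `^ (2 * d%:R / (d%:R + 2)) * ln n%:R `^ (2 / (d%:R + 2)))))].
Proof.
move=> d3 kap0; set D := d%:R : R.
have D3 : 3 <= D by rewrite ler_nat.
have D0 : 0 < D by lra.
set E := 128 * D * (2 * D + 2).
have E1 : 1 <= E by rewrite /E; nra.
have E0 : 0 < E by lra.
set eta := (Num.sqrt E)^-1.
have eta0 : 0 < eta by rewrite invr_gt0 sqrtr_gt0.
have eta1 : eta <= 1.
  by rewrite invf_le1 ?sqrtr_gt0// -[leLHS]sqrtr1 ler_wsqrtr.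
have etaE : eta ^+ 2 = E^-1 by rewrite exprVn sqr_sqrtr// ltW.
set del := eta ^+ d / 2.
have del0 : 0 < del by rewrite divr_gt0// exprn_gt0.
have etad1 : eta ^+ d <= 1 by rewrite exprn_ile1// ltW.
set C0 := ln kap - 4 * ln del + 12 / 5 * ln 100.
set c0 := Num.min (Num.min 2 (2 * kap)^-1) (Num.min (64^-1) (del / 60)).
have c00 : 0 < c0 by rewrite !lt_min (divr_gt0 del0)// !invr_gt0 (mulr_gt0 _ kap0)//= !ltr0n.
exists (c0 / 2), (100 + 20 * `|C0| + 8 / c0 + (del ^-1) ^+ 2).
split; first by rewrite divr_gt0.
move=> n y; set lg := ln n%:R; set Lam := (X in X <= _ -> _) => Llg Ly y0 y6n.
have Lam_ge : [/\ 100 <= Lam, 20 * C0 <= Lam, 8 / c0 <= Lam & (del ^-1) ^+ 2 <= Lam].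
  have a1 : 0 <= `|C0| by [].
  have a2 : C0 <= `|C0| := ler_norm _.
  have a3 : 0 <= 8 / c0 by rewrite divr_ge0// ltW.
  have a4 : 0 <= del^-1 ^+ 2 by rewrite sqr_ge0.
  by rewrite /Lam; split; lra.
have [L100 LC0 Lc0 Ldel] := Lam_ge.
have lg100 : 100 <= lg by apply: le_trans Llg.
have lg0 : 0 < lg by lra.
have nlt : lg < n%:R.
  have [n0|n0] := posnP n; last by apply: ln_sublinear; rewrite ltr0n.
  by move: lg0; rewrite /lg n0 ln0// ltxx.
have n100 : 100 <= n%:R :> R by lra.
have n0 : (0 < n)%N by rewrite -(ltr0n R); lra.
set X := y ^+ 2 / lg.
have XL : Lam <= X by rewrite ler_pdivlMr.
have X1 : 1 <= X by lra.
have X0 : 0 < X by lra.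
set rho := X `^ (D / (D + 2)).
have D2 : 0 < D + 2 by lra.
have rho_gt0 : 0 < rho by rewrite powR_gt0.
have q35 : 3 / 5 <= D / (D + 2) by rewrite ler_pdivlMr//; lra.
have q1 : D / (D + 2) <= 1 by rewrite ler_pdivrMr//; lra.
have rhoX : rho <= X by rewrite -[leRHS](powRr1 (ltW X0)) ler_powR.
have rhodel : 1 <= del * rho.
  have h : del^-1 <= rho.
    apply: (@le_trans _ _ (X `^ (1 / 2))); last by rewrite ler_powR//; lra.
    rewrite -(@ler_pXn2r _ 2)// ?nnegrE ?invr_ge0 ?(ltW del0) ?powR_ge0//.
    rewrite -[leRHS]powR_mulrn ?powR_ge0// -powRrM (_ : 1 / 2 * 2%:R = 1); last by field.
    by rewrite powRr1 ?(ltW X0)//; exact: le_trans XL.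
  by rewrite mulrC -ler_pdivrMr// div1r.
have rho1 : 1 <= rho.
  by rewrite -[leLHS](powRr0 X) ler_powR// divr_ge0// ltW.
set K := rho * lg.
have KE : y `^ (2 * D / (D + 2)) * lg `^ (2 / (D + 2)) = K.
  have -> : y `^ (2 * D / (D + 2)) = (y ^+ 2) `^ (D / (D + 2)).
    by rewrite -powR_mulrn ?(ltW y0)// -powRrM mulrA.
  have -> : y ^+ 2 = X * lg by rewrite /X divfK// gt_eqF.
  rewrite powRM ?(ltW X0) ?(ltW lg0)// -mulrA -powRD; last first.
    by apply/implyP => _; rewrite gt_eqF.
  rewrite -mulrDl divff ?gt_eqF// powRr1// ltW//.
have lgK : lg <= K by rewrite /K ler_peMl// ltW.
have K0 : 0 < K by rewrite mulr_gt0.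
have y2K : K <= y ^+ 2 by rewrite -ler_pdivlMr.
have y2E : y ^+ 2 = K * rho `^ (2 / D).
  rewrite /K mulrAC -[X in X * _ * _](powRr1 (ltW rho_gt0)) -powRD; last first.
    by apply/implyP => _; rewrite gt_eqF.
  rewrite /rho -powRrM (_ : D / (D + 2) * (1 + 2 / D) = 1).
    by rewrite powRr1 ?(ltW X0)// /X divfK// gt_eqF.
  by field; rewrite !gt_eqF.
set N := (Num.truncn (del * rho)).+1.
have Nlo : del * rho < N%:R by exact: Num.Theory.truncnS_gt.
have Nhi : N%:R <= eta ^+ d * rho.
  have : (Num.truncn (del * rho))%:R <= del * rho.
    by rewrite Num.Theory.truncn_le// mulr_ge0// ltW.
  by rewrite -natr1; move: rhodel; rewrite /del; lra.
have N0 : 0 < N%:R :> R by rewrite ltr0n.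
exists N, (lg / 30); split => //; first by rewrite divr_ge0// ltW.
rewrite KE.
(* Entropy against the cost of visiting [N] sites for a time [y^2 / 8]. *)
have T1 : 2 * n.*2.+1%:R ^+ (d * N) *
      expR (- (y ^+ 2 / 8) / (16 * d%:R * N%:R `^ (2 / d%:R))) <= 2 * expR (- (c0 * K)).
  rewrite -mulrA ler_pM2l//.
  have -> : n.*2.+1%:R ^+ (d * N) = expR (D * N%:R * ln n.*2.+1%:R) :> R.
    by rewrite /D -natrM expRM_natl lnK// posrE ltr0n.
  rewrite -expRD ler_expR.
  have l2 : ln n.*2.+1%:R <= 2 * lg.
    have -> : 2 * lg = ln (n%:R ^+ 2) by rewrite lnXn ?ltr0n// mulr_natl.
    rewrite ler_ln ?posrE ?ltr0n ?exprn_gt0 ?ltr0n//.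
    by rewrite -natr1 -muln2 natrM expr2; nra.
  have l0 : 0 <= ln n.*2.+1%:R :> R by rewrite ln_ge0// ler1n.
  have a1 : D * N%:R * ln n.*2.+1%:R <= 2 * D * K.
    have : N%:R <= rho by apply: le_trans Nhi _; rewrite ler_piMl// ltW.
    move=> Nrho; rewrite /K.
    apply: (@le_trans _ _ (D * rho * (2 * lg))); last first.
      by rewrite le_eqVlt; apply/orP; left; apply/eqP; ring.
    by rewrite ler_pM ?mulr_ge0 ?(ltW D0)// ler_pM2l.
  have Np : N%:R `^ (2 / D) <= eta ^+ 2 * rho `^ (2 / D).
    have -> : eta ^+ 2 = (eta ^+ d) `^ (2 / D).
      rewrite -[eta ^+ d]powR_mulrn ?(ltW eta0)// -powRrM mulrC divfK ?gt_eqF//.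
      by rewrite powR_mulrn// ltW.
    rewrite -powRM ?exprn_ge0 ?(ltW eta0) ?(ltW rho_gt0)//.
    by rewrite ge0_ler_powR ?nnegrE ?divr_ge0 ?mulr_ge0 ?exprn_ge0// ltW.
  have a2 : (2 * D + 2) * K <= y ^+ 2 / 8 / (16 * D * N%:R `^ (2 / D)).
    have pN : 0 < N%:R `^ (2 / D) by rewrite powR_gt0.
    rewrite ler_pdivlMr ?mulr_gt0// ler_pdivlMr// y2E.
    apply: (@le_trans _ _ ((2 * D + 2) * K * (16 * D * (eta ^+ 2 * rho `^ (2 / D))) * 8)).
      by rewrite ler_pM2r// ler_pM2l ?mulr_gt0//; [rewrite ler_pM2l// mulr_gt0|lra].
    rewrite etaE /E le_eqVlt; apply/orP; left; apply/eqP.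
    by field; rewrite !gt_eqF//; lra.
  rewrite -/D mulNr.
  have : c0 * K <= 2 * K by rewrite ler_pM2r// /c0 !ge_min lexx.
  move: a1 a2; lra.
have T2 : expR (- (n.+1%:R / (2 * kap * y ^+ 2))) <= expR (- (c0 * K)).
  rewrite ler_expR lerN2; apply: (@le_trans _ _ ((2 * kap)^-1 * K)).
    by rewrite ler_pM2r// /c0 !ge_min lexx !orbT.
  have -> : n.+1%:R / (2 * kap * y ^+ 2) = (2 * kap)^-1 * (n.+1%:R / y ^+ 2).
    by field; rewrite !gt_eqF.
  rewrite ler_pM2l ?invr_gt0 ?mulr_gt0//.
  rewrite ler_pdivlMr ?exprn_gt0//.
  apply: (@le_trans _ _ (y ^+ 6)); last by apply: le_trans y6n _; rewrite ler_nat.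
  have y21 : 1 <= y ^+ 2.
    by apply: le_trans y2K; apply: le_trans lgK; apply: le_trans lg100; rewrite ler1n.
  have -> : y ^+ 6 = y ^+ 2 * y ^+ 2 * y ^+ 2 by ring.
  rewrite ler_pM2r ?exprn_gt0//; apply: le_trans y2K _.
  by rewrite ler_peMr// ltW// exprn_gt0.
have T3 : expR (- (y ^+ 2 / 64)) <= expR (- (c0 * K)).
  rewrite ler_expR lerN2 mulrC ler_pM ?(ltW K0) ?(ltW c00)//.
  by rewrite /c0 !ge_min lexx !orbT.
(* At least [N] bad sites of low local time. *)
have T4 : expR (- (lg / 30 * N%:R) + kap * expR (lg / 30) * y ^+ 10 /
    (N%:R ^+ 3 * n.+1%:R)) <= expR (- (c0 * K)).
  rewrite ler_expR.
  suff h : kap * expR (lg / 30) * y ^+ 10 / (N%:R ^+ 3 * n.+1%:R) <= N%:R.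
    apply: (budget_large_values (dk := del * rho * lg) h).
    - rewrite -mulrA -/K [leRHS]mulrAC ler_pM2r// /c0 !ge_min lexx !orbT//.
    - by rewrite ler_pM2r// ltW.
    - rewrite ler_peMl ?(ltW N0)//; clear - lg100; lra.
  rewrite ler_pdivrMr ?mulr_gt0 ?exprn_gt0 ?ltr0n//.
  apply: (@le_trans _ _ ((del * rho) ^+ 4 * n%:R)); last first.
    rewrite (_ : N%:R * _ = N%:R ^+ 4 * n.+1%:R); last by ring.
    have dr0 : 0 <= del * rho by rewrite mulr_ge0// ltW.
    apply: ler_pM; [exact: exprn_ge0|exact: ler0n| |by rewrite ler_nat].
    by rewrite lerXn2r ?nnegrE ?ler0n// ltW.
  have nR : 0 < n%:R :> R by rewrite ltr0n.
  have dr0 : 0 < del * rho by rewrite mulr_gt0.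
  have e0 := expR_gt0 (lg / 30); have y10 : 0 < y ^+ 10 by rewrite exprn_gt0.
  have ke0 : 0 < kap * expR (lg / 30) by rewrite mulr_gt0.
  have dr40 : 0 < (del * rho) ^+ 4 by rewrite exprn_gt0.
  rewrite -ler_ln; [|by rewrite posrE mulr_gt0|by rewrite posrE mulr_gt0].
  have -> : ln (kap * expR (lg / 30) * y ^+ 10) = ln kap + lg / 30 + 10 * ln y.
    by rewrite (lnM ke0 y10) (lnM kap0 e0) expRK (lnXn 10 y0) mulr_natl.
  have -> : ln ((del * rho) ^+ 4 * n%:R) = 4 * (ln del + ln rho) + lg.
    by rewrite (lnM dr40 nR) (lnXn 4 dr0) (lnM del0 rho_gt0) mulr_natl.
  have lnrho : ln rho = D / (D + 2) * (2 * ln y - ln lg).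
    rewrite /rho ln_powR /X ln_div ?posrE ?exprn_gt0// lnXn//.
    by rewrite mulr_natl.
  have lnX0 : 0 <= 2 * ln y - ln lg.
    have := ln_ge0 X1; rewrite /X ln_div ?posrE ?exprn_gt0// lnXn//.
    by rewrite mulr_natl.
  have lnrho35 : 3 / 5 * (2 * ln y - ln lg) <= ln rho by rewrite lnrho ler_wpM2r.
  have lny : 6 * ln y <= lg.
    by rewrite /lg mulr_natl -lnXn// ler_ln ?posrE ?exprn_gt0.
  have lnlg := ln_le_div100 lg0.
  apply: budget_logs lnrho35 lny lnlg; last exact: ltW.
  exact: le_trans Llg.
have c0K : 4 <= c0 * K / 2.
  have : 8 / c0 <= K by apply: le_trans lgK; apply: le_trans Llg.
  by rewrite ler_pdivrMr// mulrC => h8; clear - h8; lra.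
have e5 : 5 <= expR (c0 * K / 2).
  by apply: le_trans (expR_ge1Dx _); clear - c0K; lra.
rewrite (_ : - (c0 / 2 * K) = c0 * K / 2 + - (c0 * K)); last by field.
rewrite [leRHS]expRD; apply: le_trans (ler_wpM2r (expR_ge0 (- (c0 * K))) e5).
apply: le_trans (lerD T1 (lerD (lerD T2 T3) T4)) _.
by rewrite le_eqVlt; apply/orP; left; apply/eqP; ring.
Qed.

End rate.

(** * The upper limit *)

Lemma limn_esup_le_near (R : realType) (u : nat -> \bar R) (l : \bar R) :
  (\forall n \near \oo, (u n <= l)%E) -> (limn_esup u <= l)%E.
Proof.
move=> ul; apply: (@le_trans _ _ (ereal_sup (u @` [set n | (u n <= l)%E]))).
  by apply: ereal_inf_lbound; exists [set n | (u n <= l)%E].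
by apply: ge_ereal_sup => _ [n /= un <-].
Qed.

(** What the two growth conditions on [y] provide for the fixed-[n] estimate. *)
Lemma much_less_bounds (R : realType) (y : nat -> R) (Lam : R) :
  (forall n, 0 < y n) ->
  much_less (fun n => ln n%:R `^ (1 / 2)) y ->
  much_less y (fun n => n%:R `^ (1 / 6)) ->
  \forall n \near \oo, [/\ Lam <= ln n%:R, Lam * ln n%:R <= y n ^+ 2 &
    y n ^+ 6 <= n%:R].
Proof.
move=> y0 ylo yup.
set M := Num.max Lam 1.
have M1 : 1 <= M by rewrite le_max lexx orbT.
have M0 : 0 < M by apply: lt_le_trans M1.
have LM : Lam <= M by rewrite le_max lexx.
have sM0 : 0 < Num.sqrt M by rewrite sqrtr_gt0.
have lo e : 0 < e -> \forall n \near \oo, `|ln n%:R `^ (1 / 2) / y n| <= e.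
  by move: e; exact/cvgr0_norm_le.
have up e : 0 < e -> \forall n \near \oo, `|y n / n%:R `^ (1 / 6)| <= e.
  by move: e; exact/cvgr0_norm_le.
near=> n.
have n0 : (0 < n)%N by near: n; exact: nbhs_infty_gt.
have nM : M <= ln n%:R.
  rewrite -[M]expRK ler_ln ?posrE ?expR_gt0 ?ltr0n//.
  by near: n; exact: nbhs_infty_ger.
have ln0 : 0 <= ln n%:R :> R by apply: le_trans nM; exact: ltW.
split; first exact: le_trans nM.
- apply: (@le_trans _ _ (M * ln n%:R)); first by rewrite ler_wpM2r.
  have : `|ln n%:R `^ (1 / 2) / y n| <= (Num.sqrt M)^-1.
    by near: n; apply: lo; rewrite invr_gt0.
  rewrite ger0_norm ?divr_ge0 ?powR_ge0 ?(ltW (y0 n))//.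
  rewrite ler_pdivrMr ?y0// [leRHS]mulrC ler_pdivlMr// => h.
  have -> : M * ln n%:R = (ln n%:R `^ (1 / 2) * Num.sqrt M) ^+ 2.
    rewrite exprMn sqr_sqrtr ?(ltW M0)// -powR_mulrn ?powR_ge0// -powRrM.
    by rewrite div1r mulVf ?pnatr_eq0// powRr1// mulrC.
  by rewrite lerXn2r// nnegrE ?(ltW (y0 n))// mulr_ge0 ?powR_ge0 ?sqrtr_ge0.
- have : `|y n / n%:R `^ (1 / 6)| <= 1 by near: n; apply: up.
  rewrite ger0_norm ?divr_ge0 ?powR_ge0 ?(ltW (y0 n))//.
  rewrite ler_pdivrMr ?powR_gt0 ?ltr0n// [leRHS]mul1r => h.
  have -> : n%:R = (n%:R `^ (1 / 6)) ^+ 6 :> R.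
    rewrite -powR_mulrn ?powR_ge0// -powRrM.
    by rewrite div1r mulVf ?pnatr_eq0// powRr1.
  by apply: lerXn2r; rewrite ?nnegrE ?powR_ge0 ?(ltW (y0 n)).
Unshelve. all: by end_near. Qed.

Theorem theorem2p2 (R : realType) (d : nat) (d_ge3 : (3 <= d)%N)
  (dW : measure_display) (W : measurableType dW) (P : probability W R)
  (S : nat -> {RV P >-> lattice d}) (S_srw : simple_random_walk S)
  (d0 : measure_display) (T0 : measurableType d0) (P0 : probability T0 R)
  (xi0 : {RV P0 >-> R})
  (xi0_mean : ('E_P0[xi0] = 0)%E)
  (xi0_moment2 : (0 < 'E_P0[fun t => (xi0 t ^+ 2)%R])%E)
  (xi0_moment4 : ('E_P0[fun t => (xi0 t ^+ 4)%R] < +oo)%E)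
  (dX : measure_display) (X : measurableType dX) (Q : probability X R)
  (xi : lattice d -> {RV Q >-> R}) (xi_iid : iid_copies xi xi0)
  (y : nat -> R) (y_gt0 : forall n, 0 < y n)
  (y_lower : much_less (fun n => ln n%:R `^ (1 / 2)) y)
  (y_upper : much_less y (fun n => n%:R `^ (1 / 6))) :
  (limn_esup (fun n =>
     (y n `^ (- (2 * d%:R / (d%:R + 2))) *
      ln n%:R `^ (- (2 / (d%:R + 2))))%R%:E *
     lne ((Q \x P)%E
       [set w | (y n <= self_normalized (xi ^~ w.1) (S ^~ w.2) n)%R]))
   < 0)%E.
Proof.
have m2_gt0 : 0 < moment xi0 2.
  by rewrite -lte_fin -momentE//; move: xi0_moment2; rewrite unlock.
have kap0 : 0 < moment xi0 4 / moment xi0 2 ^+ 2.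
  by rewrite divr_gt0 ?exprn_gt0// moment4_gt0.
have [c [Lam [c0 HLam]]] := rate_bound d_ge3 kap0.
apply: (@le_lt_trans _ _ (- c)%:E); last by rewrite lte_fin oppr_lt0.
apply: limn_esup_le_near.
have Lam1 := much_less_bounds (Num.max Lam 1) y_gt0 y_lower y_upper.
apply: filterS Lam1 => n [L1 L2 y6].
have LM : Lam <= Num.max Lam 1 by rewrite le_max lexx.
have M1 : 1 <= Num.max Lam 1 by rewrite le_max lexx orbT.
have ln0 : 0 < ln n%:R :> R by apply: lt_le_trans L1; apply: lt_le_trans M1.
have [N [tau [n0 N0 tau0 HB]]] := HLam n (y n) (le_trans LM L1)
  (le_trans (ler_wpM2r (ltW ln0) LM) L2) (y_gt0 n) y6.
have := joint_le d_ge3 S_srw xi0_mean xi0_moment4 xi_iid m2_gt0 n0 N0 (y_gt0 n) tau0.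
set p := (_ \x _)%E _ => pB.
rewrite !powRN -invfM.
set K := y n `^ _ * ln n%:R `^ _ in HB *.
have K0 : 0 < K by rewrite mulr_gt0 ?powR_gt0.
have {HB} pK : (p <= (expR (- (c * K)))%:E)%E.
  by apply: le_trans pB _; rewrite lee_fin.
have -> : (- c)%:E = ((K^-1)%:E * lne (expR (- (c * K)))%:E)%E.
  rewrite lne_EFin ?expR_gt0// expRK -EFinM; congr EFin.
  by field; rewrite gt_eqF.
apply: lee_wpmul2l; first by rewrite lee_fin invr_ge0 ltW.
have p0 : (0 <= p)%E by exact: measure_ge0.
by rewrite lee_lne// in_itv/= leey andbT// lee_fin expR_ge0.
Qed.
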